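(* Let $(M,g)$ be a Riemannian $n$-manifold with curvature tensor $R_{pijk}$ and let $k$ be given. Then $(M,g)$ admits a local isometric immersion in $\mathbb{R}^{n+k}$ if and only if there exists locally on $M$ a $k$-tuple of scalar fields $h^{(1)},\dots,h^{(k)}$ such that the symmetric tensor $$f_{ab}=g_{ab}-\sum_{\alpha=1}^{k}h^{(\alpha)}_{;a}h^{(\alpha)}_{;b}$$ is positive definite and $$\sum_{\alpha,\beta=1}^{k}\left(h^{(\alpha)}_{;pj}h^{(\beta)}_{;ik}-h^{(\alpha)}_{;pk}h^{(\beta)}_{;ij}\right)(A^{-1})^{\alpha\beta}=R_{pijk},$$ where $A$ is the $k\times k$ matrix-valued function with entries $A^{\alpha\beta}=\delta^{\alpha\beta}-g^{ab}h^{(\alpha)}_{;a}h^{(\beta)}_{;b}$ and $A^{-1}$ is its inverse matrix.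
   Context: All manifolds, metrics and functions are smooth. The subscript '';'' denotes covariant differentiation with respect to the Levi-Civita connection of $g$; repeated upper/lower tensor indices are summed. ''Locally'' means: on some open neighbourhood of each point of $M$. $(M,g)$ admits a local isometric immersion in $\mathbb{R}^{m}$ if there exists locally on $M$ an $m$-tuple of scalar fields $u^{(1)},\dots,u^{(m)}$ with $\sum_{\tau=1}^m u^{(\tau)}_{;a}u^{(\tau)}_{;b}=g_{ab}$. Curvature convention: $R_{pijk}=g_{pl}R^{l}{}_{ijk}$ with $R^{l}{}_{ijk}=\partial_j\Gamma^l_{ik}-\partial_k\Gamma^l_{ij}+\Gamma^l_{js}\Gamma^s_{ik}-\Gamma^l_{ks}\Gamma^s_{ij}$ ($\Gamma$ being the Christoffel symbols of $g$), so that the unit round sphere has $R_{pijk}=g_{pj}g_{ik}-g_{pk}g_{ij}$. *)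

(* Defs.v *)
From HB Require Import structures.
From mathcomp Require Import all_boot all_order all_algebra.
From mathcomp Require Import all_classical all_reals all_analysis.

Set Implicit Arguments.
Unset Strict Implicit.
Unset Printing Implicit Defensive.

Import Order.TTheory GRing.Theory Num.Theory.
Import numFieldNormedType.Exports.

Local Open Scope classical_set_scope.
Local Open Scope ring_scope.

Definition partiald (R : realType) (n : nat) (i : 'I_n) (f : 'rV[R]_n -> R) :
    'rV[R]_n -> R :=
  fun x => 'D_(delta_mx 0 i) f x.

(* Only meant for open U, on which the partial derivatives depend on f
   restricted to U alone. *)
Fixpoint Ck_on (R : realType) (n : nat) (m : nat) (U : set 'rV[R]_n)
    (f : 'rV[R]_n -> R) : Prop :=
  (forall x, U x -> {for x, continuous f}) /\
  match m with
  | 0 => True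
  | m'.+1 => forall i : 'I_n,
      (forall x, U x -> derivable f x (delta_mx 0 i)) /\
      Ck_on m' U (partiald i f)
  end.

Definition smooth_on (R : realType) (n : nat) (U : set 'rV[R]_n)
    (f : 'rV[R]_n -> R) : Prop :=
  forall m, Ck_on m U f.

(* [chart_map] and [chart_inv] are total functions; their values outside
   [chart_dom] and [chart_map @` chart_dom] respectively are irrelevant. *)
Record chart (R : realType) (n : nat) (M : topologicalType) := Chart {
  chart_dom : set M;
  chart_map :> M -> 'rV[R]_n;
  chart_inv : 'rV[R]_n -> M;
  chart_dom_open : open chart_dom;
  chart_img_open : open (chart_map @` chart_dom);
  chart_mapK : forall q, chart_dom q -> chart_inv (chart_map q) = q;
  chart_map_cont : forall q, chart_dom q -> {for q, continuous chart_map};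
  chart_inv_cont : forall q, chart_dom q ->
    {for chart_map q, continuous chart_inv}
}.

(* The smooth structure is the one generated by the atlas, which is not
   required to be maximal. *)
Record manifold (R : realType) (n : nat) := Manifold {
  manifold_space :> topologicalType;
  atlas : set (chart R n manifold_space);
  manifold_hausdorff : hausdorff_space manifold_space;
  manifold_second_countable : @second_countable manifold_space;
  atlas_cover : forall q : manifold_space,
    exists c, atlas c /\ chart_dom c q;
  atlas_compatible : forall c d, atlas c -> atlas d -> forall i : 'I_n,
    smooth_on (c @` (chart_dom c `&` chart_dom d))
      (fun x => d (chart_inv c x) 0 i)
}.

Definition smooth_field (R : realType) (n : nat) (M : manifold R n)
    (U : set M) (f : M -> R) : Prop :=
  forall c, atlas c ->
    smooth_on (c @` (U `&` chart_dom c)) (f \o chart_inv c).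

Definition posdefmx (R : realType) (n : nat) (A : 'M[R]_n) : Prop :=
  forall v : 'rV[R]_n, v != 0 -> 0 < (v *m A *m v^T) 0 0.

(* Entry (a, b) is the derivative of the a-th coordinate of d along the b-th
   coordinate of c. *)
Definition transition_jacobian (R : realType) (n : nat) (M : topologicalType)
    (c d : chart R n M) (q : M) : 'M[R]_n :=
  \matrix_(a, b) partiald b (fun x => d (chart_inv c x) 0 a) (c q).

(* A metric is given by its matrix of components in each chart, as a function
   of the coordinates. *)
Record riemannian_metric (R : realType) (n : nat) (M : manifold R n) :=
    RiemannianMetric {
  metric_mx :> chart R n M -> 'rV[R]_n -> 'M[R]_n;
  metric_smooth : forall c, atlas c -> forall a b : 'I_n,
    smooth_on (c @` chart_dom c) (fun x => metric_mx c x a b);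
  metric_sym : forall c, atlas c -> forall q, chart_dom c q ->
    (metric_mx c (c q))^T = metric_mx c (c q);
  metric_posdef : forall c, atlas c -> forall q, chart_dom c q ->
    posdefmx (metric_mx c (c q));
  metric_tensorial : forall c d, atlas c -> atlas d ->
    forall q, chart_dom c q -> chart_dom d q ->
    metric_mx c (c q) =
      (transition_jacobian c d q)^T *m metric_mx d (d q)
        *m transition_jacobian c d q
}.

Section Coordinates.
Context (R : realType) (n : nat) (G : 'rV[R]_n -> 'M[R]_n).

(* Gamma^l_{ij} *)
Definition christoffel (l i j : 'I_n) (x : 'rV[R]_n) : R :=
  2^-1 * \sum_(s < n) invmx (G x) l s *
    (partiald i (fun y => G y s j) x + partiald j (fun y => G y s i) x
     - partiald s (fun y => G y i j) x).

(* R^l_{ijk} *)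
Definition riemann_up (l i j k : 'I_n) (x : 'rV[R]_n) : R :=
  partiald j (christoffel l i k) x - partiald k (christoffel l i j) x
  + \sum_(s < n) christoffel l j s x * christoffel s i k x
  - \sum_(s < n) christoffel l k s x * christoffel s i j x.

(* R_{pijk} = g_{pl} R^l_{ijk} *)
Definition riemann (p i j k : 'I_n) (x : 'rV[R]_n) : R :=
  \sum_(l < n) G x p l * riemann_up l i j k x.

(* f_{;ab} *)
Definition hessian (f : 'rV[R]_n -> R) (a b : 'I_n) (x : 'rV[R]_n) : R :=
  partiald b (partiald a f) x
  - \sum_(s < n) christoffel s a b x * partiald s f x.

End Coordinates.

Section Components.
Context (R : realType) (n : nat) (M : manifold R n) (g : riemannian_metric M).
Context (c : chart R n M) (q : M).

(* Components at the point q, in the chart c, of tensors on (M, g). *)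

Definition metric_at (a b : 'I_n) : R := g c (c q) a b.

Definition inv_metric_at (a b : 'I_n) : R := invmx (g c (c q)) a b.

Definition curvature_at (p i j k : 'I_n) : R := riemann (g c) p i j k (c q).

Definition cov1 (f : M -> R) (a : 'I_n) : R :=
  partiald a (f \o chart_inv c) (c q).

Definition cov2 (f : M -> R) (a b : 'I_n) : R :=
  hessian (g c) (f \o chart_inv c) a b (c q).

End Components.

Definition local_isometric_immersion (R : realType) (n : nat)
    (M : manifold R n) (g : riemannian_metric M) (m : nat) : Prop :=
  forall q0 : M, exists U : set M, [/\ open U, U q0 &
    exists u : 'I_m -> M -> R,
      (forall t, smooth_field U (u t)) /\
      forall c q, atlas c -> chart_dom c q -> U q -> forall a b : 'I_n,
        \sum_(t < m) cov1 c q (u t) a * cov1 c q (u t) b = metric_at g c q a b].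

(* g_{ab} - sum_alpha h^alpha_{;a} h^alpha_{;b} *)
Definition reduced_metric (R : realType) (n k : nat) (M : manifold R n)
    (g : riemannian_metric M) (h : 'I_k -> M -> R) (c : chart R n M) (q : M) :
    'M[R]_n :=
  \matrix_(a, b) (metric_at g c q a b
                  - \sum_(al < k) cov1 c q (h al) a * cov1 c q (h al) b).

(* delta^{alpha beta} - g^{ab} h^alpha_{;a} h^beta_{;b}.  When
   [reduced_metric] is positive definite this matrix is invertible, by
   det (reduced_metric) = det g * det A, so that [invmx] is its inverse. *)
Definition gradient_mx (R : realType) (n k : nat) (M : manifold R n)
    (g : riemannian_metric M) (h : 'I_k -> M -> R) (c : chart R n M) (q : M) :
    'M[R]_k :=
  \matrix_(al, be) ((al == be)%:R
    - \sum_(a < n) \sum_(b < n)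
        inv_metric_at g c q a b * cov1 c q (h al) a * cov1 c q (h be) b).

(* Main.v *)
Require Import Defs.
From HB Require Import structures.
From mathcomp Require Import all_boot all_order all_algebra.
From mathcomp Require Import all_classical all_reals all_analysis.
From mathcomp Require Import ring lra.

Set Implicit Arguments.
Unset Strict Implicit.
Unset Printing Implicit Defensive.

Import Order.TTheory GRing.Theory Num.Theory.
Import numFieldNormedType.Exports.

Local Open Scope classical_set_scope.
Local Open Scope ring_scope.

(** In an isometric immersion u of (M, g) into a space of dimension n + k, the
last k coordinates h leave the form f = g - sum dh dh to be produced by the
other n coordinates.  A symmetric form f on an n-manifold is locally a sum of
n squares of differentials, the differentials being independent, exactly when
it is a flat Riemannian metric.  So the theorem amounts to two facts: the
displayed equation says that f is flat, and flat metrics have flat coordinates.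

The first fact is a Gauss equation.  In a chart let G be the matrix of g, let H
be the Jacobian matrix of h, F = G - H^T H and A = 1 - H G^-1 H^T, and collect
the second covariant derivatives h_{;ij} into matrices S_j with rows indexed by
the functions and columns by i.  Passing from G to F changes the Christoffel
symbols of the first kind only by H^T d_j H, and A^-1 = 1 + H F^-1 H^T.
Inserting both into the formula for the curvature with its first index lowered
gives F R^F_{jl} = G R^G_{jl} - (S_j^T A^-1 S_l - S_l^T A^-1 S_j), which is
[gauss_equation]; no term with third derivatives of h survives, because mixed
partial derivatives commute.

From an immersion to h: n of the n + k coordinates have independent
differentials at a given point, hence near it.  The Gram matrix F of these
differentials is positive definite, and it is flat because it is J^T J with J
an invertible Jacobian matrix ([flat_gram]).  The other k coordinates are h.

From h to an immersion: the flat metric F has to be written as J^T J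
([flat_coordinates]).  Functions u whose differential w is parallel satisfy the
linear system d_j u = w_j, d_j w_i = Gamma^l_{ji} w_l, and its integrability
conditions are the flatness of F and the symmetry of the Christoffel symbols.
Along a matrix w of n solutions w F^-1 w^T is constant, so an initial value with
w^T w = F at one point, given by [posdef_sqrt], leads to w^T w = F nearby.

Integrable linear systems d_j W = W B_j are solved in [linear_frobenius] by
Picard iteration on a ball.  The iteration uses the operator K of the Poincare
lemma, which integrates a 1-form along rays: d_i (K F) differs from F_i by a
radial integral of the curl of F, so that each step shrinks both the difference
of consecutive iterates and the defect d_i W - W B_i by a constant factor.  The
limit satisfies the system, and the system makes it smooth.

Finally, both conditions are tensorial: differentials and metrics in two charts
are related by the Jacobian matrix of the transition map ([chart_grad_chain]),
so that it is enough to construct functions in one chart around each point. *)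

(** * Mean values along lines *)

Lemma continuous_ptP {R : realType} {T : topologicalType} (f : T -> R) x :
  {for x, continuous f} <->
  (forall e : R, 0 < e -> \forall y \near x, `|f x - f y| <= e).
Proof. exact: cvgrPdist_le. Qed.

Section Lines.
Context {R : realType} {V : normedModType R}.
Implicit Types (f : V -> R) (x v : V).

Lemma is_derive_line f x v (s : R) : derivable f (x + s *: v) v ->
  is_derive s (1 : R) (fun t : R => f (x + t *: v)) ('D_v f (x + s *: v)).
Proof.
have E : (fun h : R => h^-1 *:
    (((fun t : R => f (x + t *: v)) \o shift s) (h *: (1 : R)) - f (x + s *: v))) =
  (fun h : R => h^-1 *: ((f \o shift (x + s *: v)) (h *: v) - f (x + s *: v))).
  apply/funext => h /=; congr (_ *: (f _ - _)).
  by rewrite scaler1 scalerDl addrCA addrC -addrA.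
by move=> df; split; rewrite /derivable /derive E.
Qed.

Lemma is_derive_eps f x v (L : R) :
  (forall e : R, 0 < e -> exists2 d : R, 0 < d &
    forall s : R, `|s| < d -> `|f (x + s *: v) - f x - s * L| <= e * `|s|) ->
  is_derive x v f L.
Proof.
move=> key.
have lim : (fun s : R => s^-1 *: ((f \o shift x) (s *: v) - f x)) @ 0^' --> L.
  apply/cvgrPdist_le => e e0; have [dl dl0 dlP] := key e e0.
  have H : \forall s \near (0 : R)^', s != 0 /\ `|s| < dl.
    near=> s; split; first by near: s; exact: nbhs_dnbhs_neq.
    near: s; exact: dnbhs0_lt.
  apply: filterS H => s [s0 sdl] /=.
  have := dlP s sdl; rewrite [x + _]addrC => H.
  rewrite distrC -(ler_pM2r (x := `|s|)) ?normr_gt0 // -normrM mulrBl [L * s]mulrC.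
  by rewrite /GRing.scale /= mulrAC mulVf // mul1r.
split; first by apply/cvg_ex; exists L.
exact: cvg_lim lim.
Unshelve. all: by end_near. Qed.

Lemma mvt_line f x v (t : R) :
  (forall s : R, `|s| <= `|t| -> derivable f (x + s *: v) v) ->
  exists2 s : R, `|s| <= `|t| & f (x + t *: v) - f x = t * 'D_v f (x + s *: v).
Proof.
move=> df; pose phi (s : R) := f (x + s *: v).
have dphi (s : R) : `|s| <= `|t| -> is_derive s (1 : R) phi ('D_v f (x + s *: v)).
  by move=> st; apply/is_derive_line/df.
have cphi (s : R) : `|s| <= `|t| -> {for s, continuous phi}.
  move=> /dphi[+ _] => /derivable1_diffP; exact: differentiable_continuous.
have [t0|t0] := leP 0 t.
  have [||s + E] := @MVT_segment _ phi (fun s => 'D_v f (x + s *: v)) 0 t t0.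
  - by move=> s; rewrite in_itv /= => /andP[s0 st]; apply: dphi; rewrite !ger0_norm // ltW.
  - apply: continuous_in_subspaceT => s; rewrite inE /= in_itv /= => /andP[s0 st].
    by apply: cphi; rewrite !ger0_norm.
  - rewrite in_itv /= => /andP[s0 st]; exists s; first by rewrite !ger0_norm.
    by move: E; rewrite /phi scale0r addr0 subr0 mulrC.
have [||s + E] := @MVT_segment _ phi (fun s => 'D_v f (x + s *: v)) t 0 (ltW t0).
- move=> s; rewrite in_itv /= => /andP[s0 st]; apply: dphi.
  by rewrite !ler0_norm // ?lerN2 ltW.
- apply: continuous_in_subspaceT => s; rewrite inE /= in_itv /= => /andP[s0 st].
  by apply: cphi; rewrite !ler0_norm ?lerN2 // ltW.
- rewrite in_itv /= => /andP[s0 st]; exists s.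
    by rewrite !ler0_norm ?lerN2 // ltW.
  move: E; rewrite /phi scale0r addr0 sub0r mulrN => /(congr1 -%R).
  by rewrite opprK opprB mulrC.
Qed.

End Lines.

(** * Differentiability from partial derivatives *)

Lemma is_diff_eps {R : realType} {V W : normedModType R} (f : V -> W)
    (df : {linear V -> W}) (x : V) : continuous df ->
  (forall e : R, 0 < e ->
    \forall h \near (0 : V), `|f (h + x) - (f x + df h)| <= e * `|h|) ->
  is_diff x f df.
Proof.
move=> dfc dfE.
have E : f \o shift x = cst (f x) + df +o_ 0 id by apply/eqaddoP.
have dE := diff_unique dfc E.
by split; [apply/diff_locallyP; rewrite dE | exact: dE].
Qed.

Section Total.
Context {R : realType} {n : nat}.
Implicit Types (f : 'rV[R]_n -> R) (x v : 'rV[R]_n).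

Lemma normr_coord x (i : 'I_n) : `|x 0 i| <= `|x|.
Proof.
rewrite [leRHS]/Num.norm /= mx_normrE; apply/bigmax_geP; right => /=.
by exists (0, i).
Qed.

Lemma normr_rV_le x (e : R) : 0 <= e -> (forall i, `|x 0 i| <= e) -> `|x| <= e.
Proof.
move=> e0 xe; rewrite /Num.norm /= mx_normrE; apply/bigmax_leP; split => //.
by move=> [i j] _ /=; rewrite ord1.
Qed.

Let L f x v := \sum_i v 0 i * partiald i f x.
Let L_lin f x : linear (L f x).
Proof.
move=> a u v; rewrite /L scaler_sumr -big_split; apply: eq_bigr => i _ /=.
by rewrite !mxE /= mulrDl -mulrA.
Qed.
HB.instance Definition _ f x := GRing.isLinear.Build R 'rV[R]_n R *:%R (L f x) (L_lin f x).

Let trunc v (j : nat) : 'rV[R]_n := \row_i (if (i < j)%N then v 0 i else 0).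

(** The increment of f is split into n steps, each along one coordinate axis; the
mean value theorem turns a step into a partial derivative at a nearby point. *)
Lemma C1_is_diff f x :
  (\forall y \near x, forall i : 'I_n, derivable f y (delta_mx 0 i)) ->
  (forall i, {for x, continuous (partiald i f)}) ->
  is_diff x f (fun v => \sum_i v 0 i * partiald i f x).
Proof.
move=> df cf.
have Lc : continuous (L f x).
  apply: continuous_big => [|i _ v]; first exact: add_continuous.
by apply: (@continuousM _ _ (fun v : 'rV[R]_n => v 0 i));
    [exact: coord_continuous|exact: cst_continuous].
apply: (is_diff_eps Lc) => e e0.
  have n0 : 0 < n.+1%:R :> R by [].
  pose e' := e / n.+1%:R.
  have e'0 : 0 < e' by rewrite divr_gt0.
  have : \forall y \near x, forall i : 'I_n, derivable f y (delta_mx 0 i) /\ `|partiald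
      i f x - partiald i f y| <= e'.
    have : \forall y \near x, forall i : 'I_n, `|partiald i f x - partiald i f y| <= e'.
      by apply: (@filter_forall _ _ (fun i y =>
          `|partiald i f x - partiald i f y| <= e') _ (nbhs_filter x)) => i;
          have /continuous_ptP := cf i; apply.
    by apply: filterS2 df => y h1 h2 i; split.
  move/nbhs_ballP => [d /= d0 dP].
  apply/nbhs_ballP; exists d => //= v; rewrite -ball_normE /= sub0r normrN => vd.
  have step (i : 'I_n) :
      `|f (x + trunc v i.+1) - f (x + trunc v i) - v 0 i * partiald i f x| <= e' * `|v|.
    have Ei : trunc v i.+1 = trunc v i + v 0 i *: delta_mx 0 i.
      apply/rowP => j; rewrite !mxE eqxx /= ltnS leq_eqVlt -val_eqE /=.
      have [->|] := eqVneq j i; first by rewrite eqxx ltnn mulr1 add0r.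
      by rewrite -val_eqE /= => /negbTE ->; rewrite mulr0 addr0.
    have near_seg s : `|s| <= `|v 0 i| -> ball x d (x + trunc v i + s *: delta_mx 0 i).
      move=> sv; rewrite -ball_normE /= -addrA opprD addrA subrr sub0r normrN.
      apply: le_lt_trans vd; apply: normr_rV_le => // j; rewrite !mxE eqxx /=.
      have [->|ji] := eqVneq j i; last first.
        rewrite mulr0 addr0; case: ifP => _; rewrite ?normr0 ?normr_coord //.
      by rewrite ltnn add0r mulr1; apply: le_trans sv _; exact: normr_coord.
    rewrite Ei addrA; have [s sv E] :=
        @mvt_line _ _ f (x + trunc v i) (delta_mx 0 i) (v 0 i)
      (fun s sv => (dP _ (near_seg s sv) i).1).
    rewrite E -[in X in X - _]/(partiald i f _) -mulrBr normrM mulrC.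
    apply: ler_pM => //; last exact: normr_coord.
    by rewrite distrC; exact: (dP _ (near_seg s sv) i).2.
  have -> : f (v + x) - (f x + L f x v) =
     \sum_(i < n) (f (x + trunc v i.+1) - f (x + trunc v i) - v 0 i * partiald i f x).
    rewrite opprD addrA sumrB; congr (_ - _).
    rewrite -(big_mkord xpredT (fun i =>
        f (x + trunc v i.+1) - f (x + trunc v i))) telescope_sumr //.
    congr (f _ - f _).
      by rewrite addrC; congr (_ + _); apply/rowP => j; rewrite !mxE ltn_ord.
    by rewrite -[LHS]addr0; congr (_ + _); apply/rowP => j; rewrite !mxE.
  apply: le_trans (ler_norm_sum _ _ _) _.
  apply: le_trans (ler_sum _ (fun i _ => step i)) _.
  rewrite sumr_const card_ord -mulr_natl mulrA ler_wpM2r //.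
  rewrite /e' mulrCA ger_pMr // ler_pdivrMr // mul1r ler_nat //.
Qed.

End Total.

(** * Closure properties of C^m functions *)

Section Ck.
Context {R : realType} {n : nat}.
Implicit Types (f g : 'rV[R]_n -> R) (U V : set 'rV[R]_n) (m : nat).
Implicit Types (x : 'rV[R]_n) (i j : 'I_n).

Lemma partiald_near i f g x : (\near x, f x = g x) ->
  partiald i f x = partiald i g x.
Proof. exact: near_eq_derive. Qed.

Lemma partiald_on U i f g x : open U -> U x -> (forall y, U y -> f y = g y) ->
  partiald i f x = partiald i g x.
Proof.
move=> oU Ux fg; apply: partiald_near; near=> y; apply: fg; near: y.
exact: open_nbhs_nbhs.
Unshelve. all: by end_near. Qed.

Lemma Ck_on_sub m U V f : V `<=` U -> Ck_on m U f -> Ck_on m V f.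
Proof.
elim: m f => [|m IH] f VU /= [cf df]; split => //; first by move=> x /VU /cf.
  by move=> x /VU /cf.
by move=> i; have [d1 d2] := df i; split; [move=> x /VU /d1 | exact: IH].
Qed.

Lemma Ck_on_cont m U f x : Ck_on m U f -> U x -> {for x, continuous f}.
Proof. by case: m => [|m] [cf _] /cf. Qed.

Lemma Ck_on_pred m U f : Ck_on m.+1 U f -> Ck_on m U f.
Proof.
elim: m f => [|m IH] f [cf df]; split => // i.
by have [d1 d2] := df i; split => //; exact: IH.
Qed.

Lemma Ck_on_derivable m U f x i : Ck_on m.+1 U f -> U x ->
  derivable f x (delta_mx 0 i).
Proof. by move=> [_ /(_ i)[+ _]] => /[apply]. Qed.

Lemma Ck_on_partial m U f i : Ck_on m.+1 U f -> Ck_on m U (partiald i f).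
Proof. by case=> _ /(_ i)[]. Qed.

Lemma Ck_on_ext m U f g : open U -> (forall x, U x -> f x = g x) ->
  Ck_on m U f -> Ck_on m U g.
Proof.
move=> oU; have nE (f' g' : 'rV[R]_n -> R) x : (forall x, U x -> f' x = g' x) -> U x ->
    \near x, f' x = g' x.
  by move=> fg Ux; near=> y; apply: fg; near: y; exact: open_nbhs_nbhs.
have cE (f' g' : 'rV[R]_n -> R) : (forall x, U x -> f' x = g' x) ->
   (forall x, U x -> {for x, continuous f'}) -> forall x, U x -> {for x, continuous g'}.
  move=> fg cf x Ux; apply/continuous_ptP => e e0; near=> y.
  rewrite -!fg //; last by near: y; exact: open_nbhs_nbhs.
  by near: y; exact: (continuous_ptP _ _).1 (cf x Ux) e e0.
elim: m f g => [|m IH] f g fg [cf df]; (split; first exact: cE fg cf) => // i.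
have [d1 d2] := df i; split.
  by move=> x Ux; apply: near_eq_derivable (d1 x Ux); exact: nE.
by apply: IH d2 => x Ux; exact: partiald_on fg.
Unshelve. all: by end_near. Qed.

Lemma partiald_cst i (c : R) x : partiald i (cst c) x = 0.
Proof. exact: derive_cst. Qed.

Lemma partialdD i f g x : derivable f x (delta_mx 0 i) -> derivable g x (delta_mx 0 i) ->
  partiald i (fun y => f y + g y) x = partiald i f x + partiald i g x.
Proof. by move=> df dg; exact: deriveD. Qed.

Lemma partialdB i f g x : derivable f x (delta_mx 0 i) -> derivable g x (delta_mx 0 i) ->
  partiald i (fun y => f y - g y) x = partiald i f x - partiald i g x.
Proof. by move=> df dg; exact: deriveB. Qed.

Lemma partialdM i f g x : derivable f x (delta_mx 0 i) -> derivable g x (delta_mx 0 i) ->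
  partiald i (fun y => f y * g y) x = f x * partiald i g x + g x * partiald i f x.
Proof. by move=> df dg; rewrite /partiald [LHS]deriveM. Qed.

Lemma partiald_sum (I : Type) (r : seq I) i (F : I -> 'rV[R]_n -> R) x :
  (forall k, derivable (F k) x (delta_mx 0 i)) ->
  derivable (fun y => \sum_(k <- r) F k y) x (delta_mx 0 i) /\
  partiald i (fun y => \sum_(k <- r) F k y) x = \sum_(k <- r) partiald i (F k) x.
Proof.
move=> dF; elim: r => [|k r [IH1 IH2]].
  have -> : (fun y => \sum_(k <- [::]) F k y) = cst 0.
    by apply/funext => y; rewrite big_nil.
  by rewrite partiald_cst big_nil; split => //; exact: derivable_cst.
have -> : (fun y => \sum_(k <- k :: r) F k y) = (fun y => F k y + \sum_(k <- r) F k y).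
  by apply/funext => y; rewrite big_cons.
by split; [exact: derivableD | rewrite partialdD // IH2 big_cons].
Qed.

Lemma Ck_on_cst m U (c : R) : Ck_on m U (cst c).
Proof.
elim: m c => [|m IH] c; (split; first by move=> x _; exact: cst_continuous) => // i.
split; first by move=> x _; exact: derivable_cst.
rewrite (_ : partiald i (cst c) = cst 0) //.
by apply/funext => x; exact: partiald_cst.
Qed.

Lemma Ck_onD m U f g : open U -> Ck_on m U f -> Ck_on m U g ->
  Ck_on m U (fun x => f x + g x).
Proof.
move=> oU; elim: m f g => [|m IH] f g [cf df] [cg dg];
  (split; first by move=> x Ux; apply: continuousD; [exact: cf|exact: cg]) => // i.
have [df1 df2] := df i; have [dg1 dg2] := dg i; split.
  by move=> x Ux; apply: derivableD; [exact: df1|exact: dg1].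
apply: Ck_on_ext (IH _ _ df2 dg2) => // x Ux.
by rewrite partialdD //; [exact: df1|exact: dg1].
Qed.

Lemma Ck_onM m U f g : open U -> Ck_on m U f -> Ck_on m U g ->
  Ck_on m U (fun x => f x * g x).
Proof.
move=> oU; elim: m f g => [|m IH] f g Cf Cg; move: (Cf) (Cg) => [cf df] [cg dg];
  (split; first by move=> x Ux; apply: continuousM; [exact: cf|exact: cg]) => // i.
have [df1 df2] := df i; have [dg1 dg2] := dg i; split.
  by move=> x Ux; apply: derivableM; [exact: df1|exact: dg1].
apply: Ck_on_ext (Ck_onD oU (IH _ _ (Ck_on_pred Cf) dg2) (IH _ _ (Ck_on_pred Cg) df2))
    => // x Ux.
by rewrite partialdM //; [exact: df1|exact: dg1].
Qed.

Lemma Ck_onN m U f : open U -> Ck_on m U f -> Ck_on m U (fun x => - f x).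
Proof.
move=> oU Cf; apply: Ck_on_ext (Ck_onM oU (Ck_on_cst m U (-1)) Cf) => // x _.
by rewrite mulN1r.
Qed.

Lemma Ck_onB m U f g : open U -> Ck_on m U f -> Ck_on m U g ->
  Ck_on m U (fun x => f x - g x).
Proof. by move=> oU Cf Cg; apply: Ck_onD => //; exact: Ck_onN. Qed.

Lemma Ck_on_sum (I : Type) (r : seq I) m U (F : I -> 'rV[R]_n -> R) : open U ->
  (forall k, Ck_on m U (F k)) -> Ck_on m U (fun x => \sum_(k <- r) F k x).
Proof.
move=> oU CF; elim: r => [|k r IH].
  by apply: Ck_on_ext (Ck_on_cst m U 0) => // x _; rewrite big_nil.
by apply: Ck_on_ext (Ck_onD oU (CF k) IH) => // x _; rewrite big_cons.
Qed.

Lemma Ck_on_prod (I : Type) (r : seq I) m U (F : I -> 'rV[R]_n -> R) : open U ->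
  (forall k, Ck_on m U (F k)) -> Ck_on m U (fun x => \prod_(k <- r) F k x).
Proof.
move=> oU CF; elim: r => [|k r IH].
  by apply: Ck_on_ext (Ck_on_cst m U 1) => // x _; rewrite big_nil.
by apply: Ck_on_ext (Ck_onM oU (CF k) IH) => // x _; rewrite big_cons.
Qed.

Lemma Ck_onV m U f : open U -> (forall x, U x -> f x != 0) -> Ck_on m U f ->
  Ck_on m U (fun x => (f x)^-1).
Proof.
move=> oU f0; elim: m => [|m IH] Cf; move: (Cf) => [cf df];
  (split; first by move=> x Ux; apply: continuousV; [exact: f0|exact: cf]) => // i.
have [df1 df2] := df i; split.
  by move=> x Ux; apply: derivableV; [exact: f0|exact: df1].
have CV := IH (Ck_on_pred Cf).
apply: Ck_on_ext (Ck_onN oU (Ck_onM oU (Ck_onM oU CV CV) df2)) => // x Ux.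
rewrite /partiald [RHS]deriveV ?f0 //; last exact: df1.
by rewrite /= -invrM ?unitfE ?f0 // -expr2 scaleNr.
Qed.

Lemma is_derive_coordv x v i : is_derive x v (fun y : 'rV[R]_n => y 0 i) (v 0 i).
Proof.
have H : is_diff x (fun y : 'rV[R]_n => y 0 i) (fun y : 'rV[R]_n => y 0 i).
  have @l : {linear 'rV[R]_n -> R}.
    by exists (fun N : 'rV[R]_n => N 0 i); do 2![eexists]; do ?[constructor];
     rewrite ?mxE// => ? *; rewrite ?mxE//; move=> ?; rewrite !mxE.
  rewrite (_ : (fun _ => _) = l) //; apply: is_diff_eps => [|e e0].
    exact: coord_continuous.
  by near=> h; rewrite linearD addrC [_ + l x]addrC addNr normr0 mulr_ge0 // ltW.
split; first exact: diff_derivable.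
by rewrite deriveE // diff_val.
Unshelve. all: by end_near. Qed.

Lemma is_derive_coord x i j :
  is_derive x (delta_mx 0 j : 'rV[R]_n) (fun y : 'rV[R]_n => y 0 i) ((i == j)%:R).
Proof. by apply: is_derive_eq (is_derive_coordv _ _ _) _; rewrite mxE /= eq_sym. Qed.

Lemma partiald_coord i j x : partiald i (fun y => y 0 j) x = (j == i)%:R.
Proof. exact: (@derive_val _ _ _ _ _ _ _ (is_derive_coord x j i)). Qed.

Lemma Ck_on_coord m U i : Ck_on m U (fun x => x 0 i).
Proof.
case: m => [|m]; first by split=> // x _; exact: coord_continuous.
split; first by move=> x _; exact: coord_continuous.
move=> j; split; first by move=> x _;
    exact: (@ex_derive _ _ _ _ _ _ _ (is_derive_coord x i j)).
rewrite (_ : partiald j _ = cst ((i == j)%:R)); first exact: Ck_on_cst.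
by apply/funext => x; exact: partiald_coord.
Qed.

Lemma C1_is_diff_on m U f x : open U -> U x -> Ck_on m.+1 U f ->
  is_diff x f (fun v => \sum_i v 0 i * partiald i f x).
Proof.
move=> oU Ux Cf; apply: C1_is_diff.
  have H : nbhs x U by apply: open_nbhs_nbhs; split.
  move: H.
  by apply: filterS => y Uy i; exact: (Ck_on_derivable Cf Uy).
by move=> i; exact: Ck_on_cont (Ck_on_partial i Cf) Ux.
Qed.

End Ck.

(** * Symmetry of second derivatives *)

Section Schwarz.
Context {R : realType} {n : nat}.
Implicit Types (f g : 'rV[R]_n -> R) (U : set 'rV[R]_n) (x : 'rV[R]_n) (i j : 'I_n).

(** The mean value theorem in direction i, applied to y |-> f (y + h e_j) - f y, and
then in direction j.  The left-hand side is symmetric in i and j, which is what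
[schwarz] exploits. *)
Let second_diff U f x (i j : 'I_n) (h : R) : Ck_on 2 U f ->
  (forall y, `|y - x| <= 2 * `|h| -> U y) ->
  exists2 y, `|y - x| <= 2 * `|h| &
   f (x + h *: delta_mx 0 i + h *: delta_mx 0 j) - f (x + h *: delta_mx 0 i)
     - f (x + h *: delta_mx 0 j) + f x =
   h * (h * partiald j (partiald i f) y).
Proof.
move=> Cf BU; pose d k : 'rV[R]_n := delta_mx 0 k.
have nd k (s : R) : `|s *: d k| <= `|s|.
  apply: normr_rV_le => // l; rewrite !mxE normrM ler_piMr //.
  by case: (_ && _); rewrite ?normr1 ?normr0.
have in2 s t : `|s| <= `|h| -> `|t| <= `|h| -> `|x + s *: d i + t *: d j - x| <= 2 * `|h|.
  move=> sh th; rewrite [_ - x]addrC !addrA addNr add0r (le_trans (ler_normD _ _)) //.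
  by rewrite mulr_natl mulr2n lerD // (le_trans (nd _ _)).
have h0 : `|0 : R| <= `|h| by rewrite normr0.
have in1 s : `|s| <= `|h| -> `|x + s *: d i - x| <= 2 * `|h|.
  by move=> sh; have := in2 _ _ sh h0; rewrite scale0r addr0.
pose g y := f (y + h *: d j) - f y.
have shiftE y : derivable f (y + h *: d j) (d i) ->
    is_derive y (d i) (fun z => f (z + h *: d j)) (partiald i f (y + h *: d j)).
  have E : (fun s : R => s^-1 *:
      (((fun z => f (z + h *: d j)) \o shift y) (s *: d i) - f (y + h *: d j))) =
    (fun s : R => s^-1 *: ((f \o shift (y + h *: d j)) (s *: d i) - f (y + h *: d j))).
    by apply/funext => s /=; rewrite addrA.
  by move=> df; split; rewrite /derivable /derive E.
have dg s : `|s| <= `|h| -> is_derive (x + s *: d i) (d i) g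
    (partiald i f (x + s *: d i + h *: d j) - partiald i f (x + s *: d i)).
  move=> sh; apply: is_deriveB.
    by apply: shiftE; apply: (Ck_on_derivable Cf); apply: BU; exact: in2.
  by apply: derivableP; apply: (Ck_on_derivable Cf); apply: BU; exact: in1.
have [s sh Es] := @mvt_line _ _ g x (d i) h
   (fun s sh => @ex_derive _ _ _ _ _ _ _ (dg s sh)).
have [t th Et] := @mvt_line _ _ (partiald i f) (x + s *: d i) (d j) h
   (fun t th => Ck_on_derivable (Ck_on_partial i Cf) (BU _ (in2 s t sh th))).
exists (x + s *: d i + t *: d j); first exact: in2.
rewrite -[partiald j _ _]/('D_(d j) (partiald i f) _) -Et.
have := Es; have := @derive_val _ _ _ _ _ _ _ (dg s sh) => -> <-.
by rewrite /g opprB [f x - _]addrC addrA.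
Qed.

Lemma schwarz U f x i j : open U -> U x -> Ck_on 2 U f ->
  partiald i (partiald j f) x = partiald j (partiald i f) x.
Proof.
move=> oU Ux Cf; apply/eqP; rewrite -subr_eq0 -normr_le0; apply/ler_addgt0Pr => e e0.
rewrite add0r.
have e20 : 0 < e / 2 by rewrite divr_gt0.
have c k l := (continuous_ptP _ _).1
  (Ck_on_cont (Ck_on_partial k (Ck_on_partial l Cf)) Ux) _ e20.
have : \forall y \near x, [/\ U y,
   `|partiald i (partiald j f) x - partiald i (partiald j f) y| <= e / 2
   & `|partiald j (partiald i f) x - partiald j (partiald i f) y| <= e / 2].
  have H1 : nbhs x U by apply: open_nbhs_nbhs; split.
  by apply: filterS3 H1 (c i j) (c j i) => y; split.
move/nbhs_ballP => [r /= r0 rP].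
pose h : R := r / 4.
have h0 : 0 < h by rewrite divr_gt0.
have hr y : `|y - x| <= 2 * `|h| -> ball x r y.
  by rewrite -ball_normE /= distrC gtr0_norm // => /le_lt_trans; apply; rewrite /h; lra.
have BU y (yx : `|y - x| <= 2 * `|h|) : U y by have [] := rP y (hr y yx).
have [y1 /hr/rP[_ _ y1P] E1] := @second_diff U f x i j h Cf BU.
have [y2 /hr/rP[_ y2P _] E2] := @second_diff U f x j i h Cf BU.
have E : partiald j (partiald i f) y1 = partiald i (partiald j f) y2.
  have hn0 : h != 0 by rewrite gt_eqF.
  apply: (mulfI hn0); apply: (mulfI hn0).
  apply: etrans (esym E1) _; apply: etrans _ E2.
  by rewrite [x + h *: delta_mx 0 i + _]addrAC; congr (_ + _); exact: addrAC.
rewrite E distrC in y1P.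
apply: le_trans (ler_distD (partiald i (partiald j f) y2) _ _) _.
by rewrite [e in leRHS]splitr; exact: lerD y2P y1P.
Unshelve. all: by end_near. Qed.

End Schwarz.

(** * Chain rule *)

Lemma continuous_ballP {R : realType} {T : topologicalType} {V : normedModType R}
    (f : T -> V) x :
  {for x, continuous f} <->
  (forall e : R, 0 < e -> \forall y \near x, ball (f x) e (f y)).
Proof. exact: cvg_ballP. Qed.

Section Chain.
Context {R : realType} {n p : nat}.
Implicit Types (f : 'rV[R]_p -> R) (phi : 'rV[R]_n -> 'rV[R]_p)
  (U : set 'rV[R]_n) (V : set 'rV[R]_p) (m : nat) (x : 'rV[R]_n) (i : 'I_n) (a : 'I_p).

Lemma differentiable_rV {V : normedModType R} (phi : V -> 'rV[R]_p) (x : V) :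
  (forall a, differentiable (fun y => phi y 0 a) x) -> differentiable phi x.
Proof.
move=> dphi.
have -> : phi = \sum_(a < p) (fun y => phi y 0 a *: (delta_mx 0 a : 'rV[R]_p)).
  by apply/funext => y; rewrite fct_sumE [LHS]row_sum_delta.
by apply: differentiable_sum => a; exact: differentiableZl.
Qed.

Lemma derive_comp_rV {V : normedModType R} f (phi : V -> 'rV[R]_p) (x v : V) :
  is_diff (phi x) f (fun w => \sum_a w 0 a * partiald a f (phi x)) ->
  (forall a, differentiable (fun y => phi y 0 a) x) ->
  is_derive x v (f \o phi) (\sum_a partiald a f (phi x) * 'D_v (fun y => phi y 0 a) x).
Proof.
move=> [df dfE] dphi; have Dphi := differentiable_rV dphi.
split; first by apply: diff_derivable; exact: differentiable_comp.
rewrite deriveE; last exact: differentiable_comp.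
rewrite diff_comp // dfE /= -deriveE // derive_mx; last first.
  exact: diff_derivable.
by apply: eq_bigr => a _; rewrite mxE mulrC.
Qed.

Lemma chain_rule f phi U V x i : open U -> open V -> U x -> V (phi x) ->
  Ck_on 1 V f -> (forall a, Ck_on 1 U (fun y => phi y 0 a)) ->
  is_derive x (delta_mx 0 i : 'rV[R]_n) (f \o phi)
    (\sum_a partiald a f (phi x) * partiald i (fun y => phi y 0 a) x).
Proof.
move=> oU oV Ux Vx Cf Cphi; apply: derive_comp_rV; first exact: C1_is_diff_on Cf.
by move=> a; have [] := C1_is_diff_on oU Ux (Cphi a).
Qed.

Lemma Ck_on_comp f phi U V m : open U -> open V -> (forall x, U x -> V (phi x)) ->
  Ck_on m V f -> (forall a, Ck_on m U (fun y => phi y 0 a)) ->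
  Ck_on m U (f \o phi).
Proof.
move=> oU oV UV.
have cphi k : (forall a, Ck_on k U (fun y => phi y 0 a)) -> forall x, U x ->
    {for x, continuous phi}.
  move=> Cphi x Ux.
  have H (e : R) : 0 < e -> \forall y \near x, ball (phi x) e (phi y).
    move=> e0; have H a : \forall y \near x, `|phi x 0 a - phi y 0 a| < e.
      have e20 : 0 < e / 2 by rewrite divr_gt0.
      apply: filterS ((continuous_ptP _ _).1 (Ck_on_cont (Cphi a) Ux) _ e20) => y.
      by move=> /le_lt_trans; apply; rewrite ltr_pdivrMr // ltr_pMr // ltr1n.
    apply: filterS (@filter_forall _ _ (fun a y =>
        `|phi x 0 a - phi y 0 a| < e) _ (nbhs_filter x) H) => y yP.
    by split => // b a; rewrite ord1; exact: yP.
  exact/continuous_ballP.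
elim: m f => [|m IH] f Cf Cphi; (split; first by move=> x Ux; apply: continuous_comp;
  [exact: cphi Cphi x Ux|exact: Ck_on_cont Cf (UV _ Ux)]) => // i.
have C1 k (W : set 'rV[R]_n) g : Ck_on k.+1 W g -> Ck_on 1 W g.
  by elim: k => // k IHk; move/Ck_on_pred.
have C1f : Ck_on 1 V f.
  by elim: (m) Cf => // k IHk /Ck_on_pred.
have C1phi a : Ck_on 1 U (fun y => phi y 0 a) by exact: C1 (Cphi a).
have D x Ux := chain_rule i oU oV Ux (UV x Ux) C1f C1phi.
split; first by move=> x Ux; exact: (@ex_derive _ _ _ _ _ _ _ (D x Ux)).
have : Ck_on m U
    (fun x => \sum_a (partiald a f \o phi) x * partiald i (fun y => phi y 0 a) x).
  apply: Ck_on_sum => // a; apply: Ck_onM => //; last exact: Ck_on_partial.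
  by apply: IH => [|b]; [exact: Ck_on_partial|exact: Ck_on_pred].
apply: Ck_on_ext => // x Ux.
by rewrite -(@derive_val _ _ _ _ _ _ _ (D x Ux)).
Qed.

End Chain.

(** * Smooth functions *)

Section Smooth.
Context {R : realType} {n : nat}.
Implicit Types (f g : 'rV[R]_n -> R) (U V : set 'rV[R]_n) (m : nat).
Implicit Types (x : 'rV[R]_n) (i j : 'I_n).

Lemma smooth_sub U V f : V `<=` U -> smooth_on U f -> smooth_on V f.
Proof. by move=> VU sf m; exact: Ck_on_sub (sf m). Qed.
Lemma smooth_ext U f g : open U -> (forall x, U x -> f x = g x) -> smooth_on U f ->
    smooth_on U g.
Proof. by move=> oU fg sf m; exact: Ck_on_ext (sf m). Qed.
Lemma smooth_cst U (c : R) : smooth_on U (cst c : 'rV[R]_n -> R).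
Proof. by move=> m; exact: Ck_on_cst. Qed.
Lemma smoothD U f g : open U -> smooth_on U f -> smooth_on U g ->
    smooth_on U (fun x => f x + g x).
Proof. by move=> oU sf sg m; exact: Ck_onD. Qed.
Lemma smoothB U f g : open U -> smooth_on U f -> smooth_on U g ->
    smooth_on U (fun x => f x - g x).
Proof. by move=> oU sf sg m; exact: Ck_onB. Qed.
Lemma smoothM U f g : open U -> smooth_on U f -> smooth_on U g ->
    smooth_on U (fun x => f x * g x).
Proof. by move=> oU sf sg m; exact: Ck_onM. Qed.
Lemma smooth_sum (I : Type) (r : seq I) U (F : I -> 'rV[R]_n -> R) : open U ->
  (forall k, smooth_on U (F k)) -> smooth_on U (fun x => \sum_(k <- r) F k x).
Proof. by move=> oU sF m; apply: Ck_on_sum => // k; exact: sF. Qed.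
Lemma smooth_prod (I : Type) (r : seq I) U (F : I -> 'rV[R]_n -> R) : open U ->
  (forall k, smooth_on U (F k)) -> smooth_on U (fun x => \prod_(k <- r) F k x).
Proof. by move=> oU sF m; apply: Ck_on_prod => // k; exact: sF. Qed.
Lemma smoothV U f : open U -> (forall x, U x -> f x != 0) -> smooth_on U f ->
  smooth_on U (fun x => (f x)^-1).
Proof. by move=> oU f0 sf m; exact: Ck_onV. Qed.
Lemma smooth_partial U f i : smooth_on U f -> smooth_on U (partiald i f).
Proof. by move=> sf m; exact: Ck_on_partial (sf m.+1). Qed.
Lemma smooth_derivable U f x i : smooth_on U f -> U x -> derivable f x (delta_mx 0 i).
Proof. by move=> sf; exact: Ck_on_derivable (sf 1%N). Qed.
Lemma smooth_cont U f x : smooth_on U f -> U x -> {for x, continuous f}.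
Proof. by move=> sf; exact: Ck_on_cont (sf 0%N). Qed.

End Smooth.

(** * Integration over the unit interval *)

Section UnitInterval.
Context {R : realType}.
Implicit Types (h k G : R -> R).

Definition int01 h : R := \int[lebesgue_measure]_(t in `[0, 1]%classic) h t.

Definition cont01 h := forall t : R, 0 <= t <= 1 -> {for t, continuous h}.

Let mu := @lebesgue_measure R.

Lemma cont01_within h : cont01 h -> {within `[0, 1]%classic, continuous h}.
Proof.
by move=> ch; apply: continuous_in_subspaceT => t; rewrite inE /= in_itv /=; exact: ch.
Qed.

Lemma cont01_integrable h : cont01 h -> mu.-integrable `[0, 1]%classic (EFin \o h).
Proof.
move=> ch; apply: continuous_compact_integrable; first exact: segment_compact.
exact: cont01_within.
Qed.

Lemma int01D h k : cont01 h -> cont01 k ->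
  int01 (fun t => h t + k t) = int01 h + int01 k.
Proof. by move=> ch ck; rewrite /int01 RintegralD //; exact: cont01_integrable. Qed.

Lemma int01B h k : cont01 h -> cont01 k ->
  int01 (fun t => h t - k t) = int01 h - int01 k.
Proof. by move=> ch ck; rewrite /int01 RintegralB //; exact: cont01_integrable. Qed.

Lemma int01Z (a : R) h : cont01 h -> int01 (fun t => a * h t) = a * int01 h.
Proof. by move=> ch; rewrite /int01 RintegralZl //; exact: cont01_integrable. Qed.

Lemma eq_int01 h k : (forall t : R, 0 <= t <= 1 -> h t = k t) -> int01 h = int01 k.
Proof.
by move=> hk; apply: eq_Rintegral => t; rewrite inE /= in_itv /=; exact: hk.
Qed.

Lemma int01_cst (c : R) : int01 (fun=> c) = c.
Proof.
rewrite /int01 Rintegral_cst //= lebesgue_measure_itv /= lte_fin ltr01 /=.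
by rewrite oppr0 addr0 mulr1.
Qed.

Lemma int01_norm_le (C : R) h : cont01 h ->
  (forall t : R, 0 <= t <= 1 -> `|h t| <= C) -> `|int01 h| <= C.
Proof.
move=> ch hC; apply: le_trans (le_normr_Rintegral _ (cont01_integrable ch)) _ => //.
rewrite -[leRHS]int01_cst; apply: le_Rintegral => //.
- apply: cont01_integrable => t t01; have := ch t t01.
  by move=> ct; apply: continuous_comp; [exact: ct|exact: norm_continuous].
- by apply: cont01_integrable => t _; exact: cst_continuous.
Qed.

Lemma int01_FTC G h : cont01 h ->
  (forall t : R, 0 <= t <= 1 -> is_derive t (1 : R) G (h t)) -> int01 h = G 1 - G 0.
Proof.
move=> ch dG; have cG (t : R) : 0 <= t <= 1 -> {for t, continuous G}.
  move=> /dG[+ _] => /derivable1_diffP; exact: differentiable_continuous.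
rewrite /int01 /Rintegral (@continuous_FTC2 _ h G) //.
- exact: cont01_within.
- split.
  + move=> t; rewrite in_itv /= => /andP[t0 t1].
    by have [] := dG t; rewrite ?ltW.
  + by apply: cvg_at_right_filter; apply: cG; rewrite lexx ler01.
  + by apply: cvg_at_left_filter; apply: cG; rewrite lexx ler01.
- move=> t; rewrite in_itv /= => /andP[t0 t1]; rewrite derive1E.
  by have [] := dG t; rewrite ?ltW.
Qed.

End UnitInterval.

(** * The homotopy operator of the Poincare lemma *)

Lemma line_continuous {R : realType} {V : normedModType R} (a v : V) :
  continuous (fun t : R => a + t *: v).
Proof. by move=> t; apply: cvgD; [exact: cvg_cst|apply: cvgZr_tmp; exact: cvg_id]. Qed.

Section Radial.
Context {R : realType} {n : nat} (x0 : 'rV[R]_n) (r : R).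
Let O := ball x0 r.
Implicit Types (f g : 'rV[R]_n -> R) (x y : 'rV[R]_n) (i j : 'I_n).

Definition ray x (t : R) : 'rV[R]_n := x0 + t *: (x - x0).

Lemma ray_in x (t : R) : 0 <= t <= 1 -> O x -> O (ray x t).
Proof.
move=> /andP[t0 t1]; rewrite /O -!ball_normE /ray /= opprD addNKr normrN normrZ.
rewrite distrC; apply: le_lt_trans; rewrite ger0_norm // ler_piMl //.
Qed.

Lemma ray_dist x y (t : R) : 0 <= t <= 1 -> `|ray x t - ray y t| <= `|x - y|.
Proof.
move=> /andP[t0 t1]; rewrite /ray opprD addrACA subrr add0r -scalerBr opprB addrA subrK.
by rewrite normrZ ger0_norm // ler_piMl.
Qed.

Lemma ray_cont x : continuous (ray x).
Proof.
exact: line_continuous.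
Qed.

Lemma ray_is_derive f x (t : R) : 0 <= t <= 1 -> O x -> Ck_on 1 O f ->
  is_derive t (1 : R) (f \o ray x)
    (\sum_j (x - x0) 0 j * partiald j f (ray x t)).
Proof.
move=> t01 Ox Cf.
have dray j : is_derive t (1 : R) (fun s => ray x s 0 j) ((x - x0) 0 j).
  have D := is_derive_coordv (x0 + t *: (x - x0)) (x - x0) j.
  have [d1 d2] := is_derive_line (@ex_derive _ _ _ _ _ _ _ D).
  by split=> //; rewrite -(@derive_val _ _ _ _ _ _ _ D) -d2.
have H := @derive_comp_rV R n R f (ray x) t 1 (C1_is_diff_on (ball_open _ _) (ray_in
    t01 Ox) Cf).
have [|d1 d2] := H.
  by move=> j; apply/derivable1_diffP; exact: (@ex_derive _ _ _ _ _ _ _ (dray j)).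
split=> //; rewrite d2; apply: eq_bigr => j _.
by rewrite mulrC (@derive_val _ _ _ _ _ _ _ (dray j)).
Qed.

Lemma ray_cont01 f x : O x -> (forall y, O y -> {for y, continuous f}) ->
  cont01 (f \o ray x).
Proof.
move=> Ox cf t t01; apply: continuous_comp; first exact: ray_cont.
by apply: cf; exact: ray_in.
Qed.

(** Compactness of the unit interval makes the modulus of continuity uniform along
the ray; this is what permits continuity and differentiation under the radial
integral. *)
Lemma ray_tube f x (e : R) : 0 < e -> O x -> (forall y, O y -> {for y, continuous f}) ->
  exists2 d : R, 0 < d & forall (t : R) (y : 'rV[R]_n), 0 <= t <= 1 -> `|y - ray x t| < d ->
    O y /\ `|f y - f (ray x t)| <= e.
Proof.
move=> e0 Ox cf; have e20 : 0 < e / 2 by rewrite divr_gt0.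
pose P (d t : R) := forall y, `|y - ray x t| < d -> O y /\ `|f y - f (ray x t)| <= e.
have nc : near_covering (`[(0:R), 1]%classic : set R).
  by apply/compact_near_coveringP; exact: segment_compact.
have H : \forall d \near 0^'+, `[(0:R), 1]%classic `<=` P d.
  apply: nc => t; rewrite /= in_itv /= => t01.
  have Op := ray_in t01 Ox.
  have H1 : nbhs (ray x t) O by apply: open_nbhs_nbhs; split => //; exact: ball_open.
  have H2 := (continuous_ptP _ _).1 (cf _ Op) _ e20.
  have : nbhs (ray x t) (fun y => O y /\ `|f (ray x t) - f y| <= e / 2).
    by apply: filterS2 H1 H2 => y.
  move=> /nbhs_ballP[d /= d0 dP].
  have d20 : 0 < d / 2 by rewrite divr_gt0.
  have H3 := (continuous_ballP _ _).1 (@ray_cont x t) _ d20.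
  exists ((fun s => ball (ray x t) (d / 2) (ray x s)),
          (fun d' : R => is_true (d' < d / 2))) => /=.
    by split=> //; exact: nbhs_right_lt.
  move=> [s d'] /= [sP d'P] y yP.
  have ys : ball (ray x t) d (ray x s).
    by apply: le_ball sP; rewrite ler_pdivrMr // ler_pMr // ler1n.
  have yd : ball (ray x t) d y.
    rewrite [d]splitr; apply: ball_triangle sP _.
    by rewrite -ball_normE /= distrC (lt_trans yP).
  have [Oy yE] := dP _ yd; have [_ sE] := dP _ ys.
  split => //; rewrite [e]splitr.
  apply: le_trans (ler_distD (f (ray x t)) _ _) _; apply: lerD => //.
  by rewrite distrC.
have H' : \forall d \near 0^'+, 0 < d /\ (`[(0 : R), 1]%classic `<=` P d).
  by apply: filterI H; exact: nbhs_right_gt.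
have [d [d0 dP]] := filter_ex H'.
by exists d => // t y t01; apply: dP; rewrite /= in_itv.
Unshelve. all: by end_near. Qed.

Definition radial (phi : R -> R) f x := int01 (fun t => phi t * f (ray x t)).

(** Only the weights 1 and t occur: differentiating t |-> f (ray x t) in x produces
a factor t. *)
Definition weight (phi : R -> R) :=
  continuous phi /\ forall t : R, 0 <= t <= 1 -> `|phi t| <= 1.

Lemma weight1 : weight (fun=> 1).
Proof. by split=> [t|t _]; [exact: cst_continuous|rewrite normr1]. Qed.

Lemma weight_id : weight id.
Proof. by split=> [t|t /andP[t0 t1]]; [exact: cvg_id|rewrite ger0_norm]. Qed.

Lemma radial_cont01 phi f x : weight phi -> O x ->
  (forall y, O y -> {for y, continuous f}) ->
  cont01 (fun t => phi t * f (ray x t)).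
Proof.
move=> [cphi _] Ox cf t t01; apply: continuousM; first exact: cphi.
exact: (ray_cont01 Ox cf).
Qed.

Lemma radial_le phi f x (C : R) : weight phi -> O x ->
  (forall y, O y -> {for y, continuous f}) ->
  (forall y, O y -> `|f y| <= C) -> `|radial phi f x| <= C.
Proof.
move=> wphi Ox cf fC; apply: int01_norm_le; first exact: radial_cont01.
move=> t t01; rewrite normrM -[leRHS]mul1r; apply: ler_pM => //; first exact: wphi.2.
by apply: fC; exact: ray_in.
Qed.

Lemma radialB phi f g x : weight phi -> O x -> (forall y, O y -> {for y, continuous f}) ->
  (forall y, O y -> {for y, continuous g}) ->
  radial phi (fun y => f y - g y) x = radial phi f x - radial phi g x.
Proof.
move=> wphi Ox cf cg; rewrite /radial -int01B; try exact: radial_cont01.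
by apply: eq_int01 => t _; rewrite mulrBr.
Qed.

Lemma radial_continuous phi f : weight phi -> (forall y, O y -> {for y, continuous f}) ->
  forall x, O x -> {for x, continuous (radial phi f)}.
Proof.
move=> wphi cf x Ox; apply/continuous_ptP => e e0.
have [d d0 dP] := ray_tube e0 Ox cf.
have H1 : nbhs x O by apply: open_nbhs_nbhs; split => //; exact: ball_open.
have H2 : nbhs x (ball x d) by exact: nbhsx_ballx.
apply: filterS2 H1 H2 => y Oy; rewrite -ball_normE /= => xyd.
rewrite /radial -int01B; try exact: radial_cont01.
apply: int01_norm_le.
  by move=> t t01; apply: continuousB; exact: (radial_cont01 wphi _ cf t01).
move=> t t01; rewrite -mulrBr normrM -[leRHS]mul1r; apply: ler_pM => //;
    first exact: wphi.2.
rewrite distrC; apply: (dP t (ray y t) t01 _).2.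
by apply: le_lt_trans xyd; rewrite distrC; exact: ray_dist.
Qed.

(** Integrate the derivative of t * f (ray x t) over the unit interval. *)
Lemma radial_FTC f x : O x -> Ck_on 1 O f ->
  f x = radial (fun=> 1) f x + \sum_j (x - x0) 0 j * radial id (partiald j f) x.
Proof.
move=> Ox Cf.
have cf y (Oy : O y) : {for y, continuous f} := Ck_on_cont Cf Oy.
have cdf j y (Oy : O y) : {for y, continuous (partiald j f)} :=
    Ck_on_cont (Ck_on_partial j Cf) Oy.
have csum (s : seq 'I_n) :
    cont01 (fun t => \sum_(j <- s) (x - x0) 0 j * (t * partiald j f (ray x t))).
  elim: s => [|j s IH] t t01.
    rewrite (_ : (fun _ => _) = cst 0); first exact: cst_continuous.
    by apply/funext => u; rewrite big_nil.
  rewrite (_ : (fun _ => _) = fun u =>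
      (x - x0) 0 j * (u * partiald j f (ray x u))
      + \sum_(j <- s) (x - x0) 0 j * (u * partiald j f (ray x u))); last first.
    by apply/funext => u; rewrite big_cons.
  apply: continuousD; last exact: IH.
  apply: continuousM; first exact: cst_continuous.
  exact: (radial_cont01 weight_id Ox (cdf j) t01).
have -> : \sum_j (x - x0) 0 j * radial id (partiald j f) x =
   int01 (fun t => \sum_j (x - x0) 0 j * (t * partiald j f (ray x t))).
  elim: (index_enum _) => [|j s IH].
    by rewrite big_nil -[LHS]int01_cst; apply: eq_int01 => t _; rewrite big_nil.
  rewrite big_cons IH -int01Z; last exact: (radial_cont01 weight_id Ox (cdf j)).
  rewrite -int01D //; last first.
    move=> t t01; apply: continuousM; first exact: cst_continuous.
    exact: (radial_cont01 weight_id Ox (cdf j) t01).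
  by apply: eq_int01 => t _; rewrite big_cons.
rewrite /radial -int01D //; last exact: (radial_cont01 weight1 Ox cf).
set h := fun t : R => _ + _.
have ch : cont01 h.
  move=> t t01; apply: continuousD; last exact: csum.
  exact: (radial_cont01 weight1 Ox cf t01).
have dG (t : R) : 0 <= t <= 1 ->
    is_derive t (1 : R) (fun u : R => u * (f \o ray x) u) (h t).
  move=> t01; have d1 := ray_is_derive t01 Ox Cf.
  have d2 := @is_deriveM R R _ _ t 1 _ _ (is_derive_id t (1 : R)) d1.
  apply: (is_derive_eq d2).
  rewrite addrC /h; congr (_ + _); first by rewrite /GRing.scale /= mulr1 mul1r.
  rewrite scaler_sumr; apply: eq_bigr => j _.
  by rewrite /GRing.scale /= mulrCA.
by rewrite (int01_FTC ch dG) /= mul1r mul0r subr0 /ray scale1r addrC subrK.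
Qed.

(** By the mean value theorem the difference quotient of the integrand is t times a
partial derivative at a point close to the ray, uniformly in t by [ray_tube]. *)
Lemma radial_derive f x i : O x -> Ck_on 1 O f ->
  is_derive x (delta_mx 0 i : 'rV[R]_n) (radial (fun=> 1) f) (radial id (partiald i f) x).
Proof.
move=> Ox Cf.
have cf y (Oy : O y) : {for y, continuous f} := Ck_on_cont Cf Oy.
have cdf y (Oy : O y) : {for y, continuous (partiald i f)} :=
    Ck_on_cont (Ck_on_partial i Cf) Oy.
pose d : 'rV[R]_n := delta_mx 0 i.
pose L := radial id (partiald i f) x.
have nd (s : R) : `|s *: d| <= `|s|.
  apply: normr_rV_le => // l; rewrite !mxE normrM ler_piMr //.
  by case: (_ && _); rewrite ?normr1 ?normr0.
have key (e : R) : 0 < e -> exists2 dl : R, 0 < dl & forall s : R, `|s| < dl ->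
   `|radial (fun=> 1) f (x + s *: d) - radial (fun=> 1) f x - s * L| <= e * `|s|.
  move=> e0; have [d1 d10 d1P] := ray_tube e0 Ox cdf.
  have H1 : nbhs x O by apply: open_nbhs_nbhs; split => //; exact: ball_open.
  have /nbhs_ballP[d2 /= d20 d2P] := H1.
  exists (Num.min d1 d2); first by rewrite lt_min d10.
  move=> s; rewrite lt_min => /andP[sd1 sd2].
  have Oxs : O (x + s *: d).
    apply: d2P; rewrite -ball_normE /= opprD addrA subrr sub0r normrN.
    exact: le_lt_trans (nd s) sd2.
  rewrite /radial /L /radial -int01Z; last exact: (radial_cont01 weight_id Ox cdf).
  have c1 := radial_cont01 weight1 Oxs cf.
  have c2 := radial_cont01 weight1 Ox cf.
  have c3 : cont01 (fun t => s * (t * partiald i f (ray x t))).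
    move=> t t01; apply: continuousM; first exact: cst_continuous.
    exact: (radial_cont01 weight_id Ox cdf t01).
  have c12 : cont01 (fun t => 1 * f (ray (x + s *: d) t) - 1 * f (ray x t)).
    by move=> t t01; apply: continuousB; [exact: c1|exact: c2].
  rewrite -int01B // -int01B //; apply: int01_norm_le.
    by move=> t t01; apply: continuousB; [exact: c12|exact: c3].
  move=> t t01; rewrite !mul1r.
  have -> : ray (x + s *: d) t = ray x t + (s * t) *: d.
    by rewrite /ray -[RHS]addrA; congr (_ + _);
        rewrite addrAC scalerDr scalerA [s * t]mulrC.
  have tu u : `|u| <= `|s * t| -> `|ray x t + u *: d - ray x t| < d1.
    move=> ust; rewrite addrC addrA addNr add0r; apply: le_lt_trans sd1.
    apply: le_trans (nd u) _; apply: le_trans ust _; rewrite normrM ler_piMr //.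
    by case/andP: t01 => t0 t1; rewrite ger0_norm.
  have [u ust Eu] := @mvt_line _ _ f (ray x t) d (s * t)
     (fun u us => Ck_on_derivable Cf (d1P t _ t01 (tu u us)).1).
  rewrite Eu mulrA -mulrBr normrM mulrC; apply: ler_pM => //.
    exact: (d1P t _ t01 (tu u ust)).2.
  rewrite normrM ler_piMr //.
  by case/andP: t01 => t0 t1; rewrite ger0_norm.
exact: is_derive_eps key.
Qed.

Lemma radial_Ck1 f : Ck_on 1 O f -> Ck_on 1 O (radial (fun=> 1) f).
Proof.
move=> Cf.
have cf y (Oy : O y) : {for y, continuous f} := Ck_on_cont Cf Oy.
have cdf i y (Oy : O y) : {for y, continuous (partiald i f)} :=
    Ck_on_cont (Ck_on_partial i Cf) Oy.
split; first exact: radial_continuous weight1 cf.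
move=> i; split.
  by move=> x Ox; exact: (@ex_derive _ _ _ _ _ _ _ (radial_derive i Ox Cf)).
apply: (@Ck_on_ext _ _ _ _ (radial id (partiald i f))); first exact: ball_open.
  by move=> x Ox; rewrite /partiald (@derive_val _ _ _ _ _ _ _ (radial_derive i Ox Cf)).
by split => //; exact: radial_continuous weight_id (cdf i).
Qed.

(** A primitive of the 1-form F when F is closed; see [cone_partial] otherwise. *)
Definition cone (F : 'I_n -> 'rV[R]_n -> R) x :=
  \sum_j (x - x0) 0 j * radial (fun=> 1) (F j) x.

Lemma cone_center F : cone F x0 = 0.
Proof. by rewrite /cone big1 // => j _; rewrite subrr mxE mul0r. Qed.

Let Ck_on_dcoord m j : Ck_on m O (fun x => (x - x0) 0 j).
Proof.
have := Ck_onB (@ball_open _ _ x0 r) (Ck_on_coord m O j) (Ck_on_cst m O (x0 0 j)).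
by apply: Ck_on_ext; [exact: ball_open|move=> x _; rewrite !mxE].
Qed.

Lemma cone_Ck1 F : (forall j, Ck_on 1 O (F j)) -> Ck_on 1 O (cone F).
Proof.
move=> CF; apply: Ck_on_sum; first exact: ball_open.
by move=> j; apply: Ck_onM; [exact: ball_open|exact: Ck_on_dcoord|exact: radial_Ck1].
Qed.

Let dcoord_lt x j : O x -> `|(x - x0) 0 j| <= r.
Proof.
rewrite /O -ball_normE /= distrC => /ltW; apply: le_trans; exact: normr_coord.
Qed.

Lemma cone_le F x (C : R) : O x -> (forall j, Ck_on 1 O (F j)) ->
  (forall j y, O y -> `|F j y| <= C) -> `|cone F x| <= n%:R * r * C.
Proof.
move=> Ox CF FC; rewrite /cone; apply: le_trans (ler_norm_sum _ _ _) _.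
rewrite -mulrA mulr_natl -[X in _ *+ X]card_ord -sumr_const; apply: ler_sum => j _.
rewrite normrM; apply: ler_pM => //; first exact: dcoord_lt.
apply: radial_le => //; [exact: weight1| |exact: FC].
by move=> y; exact: Ck_on_cont (CF j).
Qed.

Lemma coneB F G x : O x -> (forall j, Ck_on 1 O (F j)) -> (forall j, Ck_on 1 O (G j)) ->
  cone (fun j y => F j y - G j y) x = cone F x - cone G x.
Proof.
move=> Ox CF CG; rewrite /cone -sumrB; apply: eq_bigr => j _.
rewrite radialB ?mulrBr //; first exact: weight1.
  by move=> y; exact: Ck_on_cont (CF j).
by move=> y; exact: Ck_on_cont (CG j).
Qed.

(** Differentiating under the integral gives radial integrals of F_i and of the
d_i F_j; replacing d_i F_j by d_j F_i, at the cost of the curl, makes them sum up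
to F_i by [radial_FTC].  The factor r comes from the coordinates of x - x0. *)
Lemma cone_partial F x i (C : R) : O x -> (forall j, Ck_on 1 O (F j)) ->
  (forall j y, O y -> `|partiald i (F j) y - partiald j (F i) y| <= C) ->
  `|partiald i (cone F) x - F i x| <= n%:R * r * C.
Proof.
move=> Ox CF FC.
have cd j k y (Oy : O y) : {for y, continuous (partiald j (F k))} :=
    Ck_on_cont (Ck_on_partial j (CF k)) Oy.
have dE j : partiald i (fun y => (y - x0) 0 j * radial (fun=> 1) (F j) y) x =
   (x - x0) 0 j * radial id (partiald i (F j)) x + radial (fun=> 1) (F j) x * (j == i)%:R.
  have d1 := Ck_on_derivable (i := i) (Ck_on_dcoord 1 j) Ox.
  have d2 := radial_derive i Ox (CF j).
  rewrite partialdM; [|exact: d1|exact: (@ex_derive _ _ _ _ _ _ _ d2)].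
  congr (_ * _ + _ * _); first exact: (@derive_val _ _ _ _ _ _ _ d2).
  rewrite (_ : (fun y => (y - x0) 0 j) = fun y => y 0 j - cst (x0 0 j) y); last first.
    by apply/funext => y; rewrite !mxE.
  have dc := @ex_derive _ _ _ _ _ _ _ (is_derive_coord x j i).
  rewrite partialdB; [|exact: dc|exact: derivable_cst].
  by rewrite partiald_coord partiald_cst subr0.
have -> : partiald i (cone F) x - F i x =
   \sum_j (x - x0) 0 j * radial id (fun y => partiald i (F j) y - partiald j (F i) y) x.
  rewrite (radial_FTC Ox (CF i)) /cone.
  have [|_ ->] := @partiald_sum _ _ _ (index_enum _) i
      (fun j y => (y - x0) 0 j * radial (fun=> 1) (F j) y) x.
    by move=> j; apply: Ck_on_derivable (Ck_onM (ball_open _ _) (Ck_on_dcoord 1 j)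
        (radial_Ck1 (CF j))) Ox.
  rewrite (eq_bigr _ (fun j _ => dE j)) big_split /=.
  rewrite [X in _ + X - _](_ : _ = radial (fun=> 1) (F i) x); last first.
    rewrite (bigD1 i) //= eqxx mulr1 big1 ?addr0 // => j /negbTE ->.
    by rewrite mulr0.
  rewrite opprD addrA addrK -sumrB; apply: eq_bigr => j _.
  rewrite radialB ?mulrBr //; [exact: weight_id|exact: cd|exact: cd].
apply: le_trans (ler_norm_sum _ _ _) _.
rewrite -mulrA mulr_natl -[X in _ *+ X]card_ord -sumr_const; apply: ler_sum => j _.
rewrite normrM; apply: ler_pM => //; first exact: dcoord_lt.
apply: radial_le => //; [exact: weight_id| |exact: FC].
by move=> y Oy; apply: continuousB; exact: cd.
Qed.

End Radial.

(** * Integrable linear systems *)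

Section Geometric.
Context {R : realType}.

(** The sequences u m - 2 c 2^-m and u m + 2 c 2^-m are monotone and enclose the
limit, which is the supremum of the first one. *)
Lemma geometric_limit (u : nat -> R) (c : R) :
  (forall m, `|u m.+1 - u m| <= c * 2^-1 ^+ m) ->
  exists l, forall m, `|u m - l| <= 2 * c * 2^-1 ^+ m.
Proof.
move=> uc; have c0 : 0 <= c by have := uc 0%N; rewrite expr0 mulr1; exact: le_trans.
pose d m := 2 * c * 2^-1 ^+ m.
have d0 m : 0 <= d m by rewrite !mulr_ge0 // exprn_ge0.
have dS m : d m = d m.+1 + c * 2^-1 ^+ m.
  by rewrite /d exprS; move: (_ ^+ m) => e; field.
have lo_step m : u m - d m <= u m.+1 - d m.+1.
  by have := uc m; rewrite ler_norml (dS m) => /andP[h1 _]; lra.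
have hi_step m : u m.+1 + d m.+1 <= u m + d m.
  by have := uc m; rewrite ler_norml (dS m) => /andP[_ h2]; lra.
have lo k m : u m - d m <= u (m + k)%N - d (m + k)%N.
  by elim: k => [|k IH]; rewrite ?addn0 // addnS (le_trans IH).
have hi k m : u (m + k)%N + d (m + k)%N <= u m + d m.
  by elim: k => [|k IH]; rewrite ?addn0 // addnS (le_trans _ IH).
have lohi m k : u m - d m <= u k + d k.
  apply: le_trans (lo k m) _; apply: le_trans _ (hi m k); rewrite addnC.
  by have := d0 (k + m)%N; lra.
pose S : set R := [set u m - d m | m in [set: nat]].
have S0 : S !=set0 by exists (u 0%N - d 0%N); exists 0%N.
have Sub m : ubound S (u m + d m) by move=> _ [k _ <-].
have hS : has_sup S by split => //; exists (u 0%N + d 0%N); exact: Sub.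
exists (sup S) => m; rewrite ler_distlC; apply/andP; split.
  by have : u m - d m <= sup S by apply: sup_upper_bound => //; exists m.
exact: ge_sup.
Qed.

Lemma geometric_small (C e : R) : 0 < e -> exists m, C * 2^-1 ^+ m <= e.
Proof.
move=> e0; pose m := Num.bound (`|C| / e); exists m.
have h : `|C| / e < m%:R by apply: archi_boundP; rewrite divr_ge0 // ltW.
apply: le_trans (ler_norm _) _; rewrite normrM [`|_ ^+ m|]ger0_norm ?exprn_ge0 //.
rewrite exprVn ler_pdivrMr ?exprn_gt0 //.
rewrite ltr_pdivrMr // in h; apply: le_trans (ltW h) _; rewrite mulrC ler_pM2l //.
by rewrite -natrX ler_nat ltnW // ltn_expl.
Qed.

End Geometric.

Section Frobenius.
Context {R : realType} {n N : nat} (x0 : 'rV[R]_n) (r M : R).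
Variable B : 'I_n -> 'I_N -> 'I_N -> 'rV[R]_n -> R.
Let O := ball x0 r.
Hypothesis r0 : 0 < r.
Hypothesis B_smooth : forall j a b, smooth_on O (B j a b).
Hypothesis B_le : forall j a b x, O x -> `|B j a b x| <= M.
Hypothesis r_small : n%:R * r * (2 * (N%:R * M)) <= 4^-1.
Hypothesis B_flat : forall i j a b x, O x ->
  partiald i (B j a b) x + \sum_c B i a c x * B j c b x =
  partiald j (B i a b) x + \sum_c B j a c x * B i c b x.
Hypothesis M0 : 0 <= M.
Variable w0 : 'I_N -> R.

Let oO : open O. Proof. exact: ball_open. Qed.

Let rowmul (W : 'I_N -> 'rV[R]_n -> R) b j (x : 'rV[R]_n) := \sum_a W a x * B j a b x.

(** Row b of the iteration W = w0 + K (W B); [rowmul W b j] is the b-th component of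
the j-th coefficient of the 1-form W B. *)
Fixpoint picard (m : nat) (b : 'I_N) : 'rV[R]_n -> R :=
  match m with
  | 0 => cst (w0 b)
  | m'.+1 => fun x => w0 b + cone x0 (rowmul (picard m') b) x
  end.

Let rowmul_Ck k W b j : (forall a, Ck_on k O (W a)) -> Ck_on k O (rowmul W b j).
Proof.
move=> CW; apply: Ck_on_sum => // a; apply: Ck_onM => //; exact: B_smooth.
Qed.

Lemma picard_Ck1 m b : Ck_on 1 O (picard m b).
Proof.
elim: m b => [|m IH] b; first exact: Ck_on_cst.
apply: Ck_onD => //; first exact: Ck_on_cst.
by apply: cone_Ck1 => j; exact: rowmul_Ck.
Qed.

Let c0 : R := \sum_a `|w0 a|.
Let c0_ge0 : 0 <= c0. Proof. exact: sumr_ge0. Qed.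
Let w0_le a : `|w0 a| <= c0.
Proof. by rewrite /c0 (bigD1 a) //= lerDl sumr_ge0. Qed.
Let NM_ge0 : 0 <= N%:R * M. Proof. exact: mulr_ge0. Qed.
Let nr_ge0 : 0 <= n%:R * r. Proof. by rewrite mulr_ge0 // ltW. Qed.

Let rowmul_le (W : 'I_N -> R) j b x (C : R) : O x -> (forall a, `|W a| <= C) ->
  `|\sum_a W a * B j a b x| <= N%:R * M * C.
Proof.
move=> Ox WC; apply: le_trans (ler_norm_sum _ _ _) _.
rewrite -mulrA mulr_natl -[X in _ *+ X]card_ord -sumr_const; apply: ler_sum => a _.
by rewrite normrM mulrC; apply: ler_pM => //; exact: B_le.
Qed.

(** On a ball this small K (W B) is a contraction in W, with factor 1/2. *)
Lemma picard_step m b x : O x ->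
  `|picard m.+1 b x - picard m b x| <= c0 * 2^-1 ^+ m.
Proof.
have small (C : R) : 0 <= C -> n%:R * r * (N%:R * M * C) <= C / 2.
  move=> C0; rewrite mulrA mulrC; apply: ler_wpM2l => //.
  by have := r_small; have := mulr_ge0 nr_ge0 NM_ge0; lra.
elim: m b x => [|m IH] b x Ox.
  rewrite /= expr0 mulr1 addrC addKr.
  apply: le_trans (cone_le Ox (fun j => rowmul_Ck b j (picard_Ck1 0)) _) _.
    by move=> j y Oy; apply: (rowmul_le _ _ Oy) => a; exact: w0_le.
  by apply: le_trans (small _ c0_ge0) _; rewrite ler_pdivrMr // ler_peMr // ler1n.
have -> : picard m.+2 b x - picard m.+1 b x =
   cone x0 (fun j y => rowmul (picard m.+1) b j y - rowmul (picard m) b j y) x.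
  rewrite (coneB Ox); last 2 first.
    by move=> j; apply: rowmul_Ck => a; exact: picard_Ck1.
    by move=> j; apply: rowmul_Ck => a; exact: picard_Ck1.
  by rewrite /= opprD addrACA subrr add0r.
apply: le_trans (@cone_le _ _ _ _ _ _ (N%:R * M * (c0 * 2^-1 ^+ m)) Ox _ _) _.
- move=> j; apply: Ck_onB => //; apply: rowmul_Ck => a; exact: picard_Ck1.
- move=> j y Oy; rewrite /rowmul -sumrB.
  under eq_bigr do rewrite -mulrBl.
  by apply: (rowmul_le _ _ Oy) => a; exact: IH.
rewrite exprSr [leRHS]mulrA; apply: small; rewrite mulr_ge0 // exprn_ge0 //.
Qed.

(** With D_i = d_i W - W B_i, flatness of B turns the curl of W B into
D_i B_j - D_j B_i.  Hence by [cone_partial] the next defect is at most a quarter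
of the present one plus the effect of the last step on W B_i. *)
Lemma picard_defect m i b x : O x ->
  `|partiald i (picard m b) x - rowmul (picard m) b i x| <= 4 * (N%:R * M * c0) * 2^-1 ^+ m.
Proof.
set K := N%:R * M * c0; have K0 : 0 <= K by rewrite mulr_ge0.
elim: m i b x => [|m IH] i b x Ox.
  rewrite /= partiald_cst sub0r normrN expr0 mulr1.
  apply: le_trans (rowmul_le _ _ Ox w0_le) _; by rewrite -/K ler_peMl // ler1n.
set e : R := 2^-1 ^+ m; have e0 : 0 <= e by rewrite exprn_ge0.
have CP a : Ck_on 1 O (picard m a) := picard_Ck1 m a.
have CF j : Ck_on 1 O (rowmul (picard m) b j) by exact: rowmul_Ck.
pose D i a y := partiald i (picard m a) y - rowmul (picard m) a i y.
have DE y i' j : O y -> partiald i' (rowmul (picard m) b j) y =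
    \sum_a D i' a y * B j a b y + \sum_a picard m a y * (partiald i' (B j a b) y
        + \sum_c B i' a c y * B j c b y).
  move=> Oy.
  have dPB a : derivable (fun z => picard m a z * B j a b z) y (delta_mx 0 i').
    by apply: derivableM; [exact: Ck_on_derivable (CP a) Oy | exact: smooth_derivable
        (B_smooth j a b) Oy].
  have [_ ->] := partiald_sum (index_enum _) dPB.
  under eq_bigr => a _.
    rewrite partialdM; last 2 first.
      exact: Ck_on_derivable (CP a) Oy.
      exact: smooth_derivable (B_smooth j a b) Oy.
    over.
  have -> : \sum_a picard m a y * (partiald i' (B j a b) y
      + \sum_c B i' a c y * B j c b y) =
     \sum_a (picard m a y * partiald i' (B j a b) y)
         + \sum_a rowmul (picard m) a i' y * B j a b y.
    under eq_bigr do rewrite mulrDr.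
    rewrite big_split; congr (_ + _); rewrite /rowmul.
    under eq_bigr do rewrite mulr_sumr.
    under [RHS]eq_bigr do rewrite mulr_suml.
    rewrite exchange_big /=; apply: eq_bigr => a _; apply: eq_bigr => c _; exact: mulrA.
  rewrite big_split /= addrCA; congr (_ + _); rewrite -big_split; apply: eq_bigr => a _ /=.
  by rewrite /D mulrBl subrK mulrC.
have curl j y : O y ->
   `|partiald i (rowmul (picard m) b j) y - partiald j (rowmul (picard m) b i) y| <=
   2 * (N%:R * M) * (4 * K * e).
  move=> Oy; rewrite !DE //.
  under [X in _ + X - _]eq_bigr => a _ do rewrite (B_flat i j a b Oy).
  rewrite opprD addrACA subrr addr0.
  apply: le_trans (ler_normB _ _) _; rewrite -mulrA mulr_natl mulr2n; apply: lerD.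
    by apply: (rowmul_le _ _ Oy) => a; exact: IH.
  by apply: (rowmul_le _ _ Oy) => a; exact: IH.
have h1 := cone_partial (i := i) Ox CF curl.
have h2 : `|rowmul (picard m) b i x - rowmul (picard m.+1) b i x| <= K * e.
  rewrite /rowmul -sumrB; under eq_bigr do rewrite -mulrBl.
  rewrite /K -mulrA; apply: (rowmul_le _ _ Ox) => a; rewrite distrC; exact: picard_step.
have -> : partiald i (picard m.+1 b) x = partiald i (cone x0 (rowmul (picard m) b)) x.
  have dc := Ck_on_derivable (i := i) (cone_Ck1 CF) Ox.
  rewrite [LHS](@partialdD _ _ i (cst (w0 b)) _ x (derivable_cst _ _ _) dc).
  by rewrite partiald_cst add0r.
apply: le_trans (ler_distD (rowmul (picard m) b i x) _ _) _.
apply: le_trans (lerD h1 h2) _.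
have h3 : n%:R * r * (2 * (N%:R * M)) * (4 * K * e) <= 4^-1 * (4 * K * e).
  by apply: ler_wpM2r => //; rewrite !mulr_ge0.
rewrite mulrA; rewrite exprSr -/e.
have Ke0 : 0 <= K * e by rewrite mulr_ge0.
have -> : 4 * K * (e / 2) = 2 * (K * e) by field.
apply: le_trans (lerD h3 (lexx _)) _.
have -> : 4^-1 * (4 * K * e) = K * e by field.
by rewrite mulr_natl mulr2n.
Qed.

(** The iterates converge uniformly and their defects tend to 0 uniformly, so the mean
value theorem passes to the limit and gives the partial derivatives of the limit.
Smoothness follows by induction: if W is C^m then so is d_i W = W B_i. *)
Lemma frobenius_ball : exists W : 'I_N -> 'rV[R]_n -> R,
  [/\ forall b, smooth_on O (W b), forall b, W b x0 = w0 b &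
   forall x i b, O x -> partiald i (W b) x = \sum_a W a x * B i a b x].
Proof.
have lim_ex (bx : 'I_N * 'rV[R]_n) : exists l, O bx.2 ->
    forall m, `|picard m bx.1 bx.2 - l| <= 2 * c0 * 2^-1 ^+ m.
  move: bx => [b x]; have [Ox|nOx] := pselect (O x); last by exists 0.
  have [l lP] := geometric_limit (fun m => picard_step m b Ox).
  by exists l.
have [W WP] := choice lim_ex.
pose w b x := W (b, x).
have wP b x m : O x -> `|picard m b x - w b x| <= 2 * c0 * 2^-1 ^+ m by move=> Ox;
    exact: (WP (b, x)).
have w_cont b x : O x -> {for x, continuous (w b)}.
  move=> Ox; apply/continuous_ptP => e e0.
  have e30 : 0 < e / 3 by rewrite divr_gt0.
  have [m me] := geometric_small (2 * c0) e30.
  have H1 : nbhs x O by apply: open_nbhs_nbhs; split.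
  have H2 := (continuous_ptP _ _).1 (Ck_on_cont (picard_Ck1 m b) Ox) _ e30.
  apply: filterS2 H1 H2 => y Oy yP.
  have a1 := le_trans (wP b x m Ox) me; have a2 := le_trans (wP b y m Oy) me.
  rewrite distrC in a1.
  apply: le_trans (ler_distD (picard m b x) _ _) _.
  apply: le_trans (lerD a1 (ler_distD (picard m b y) _ _)) _.
  apply: le_trans (lerD (lexx _) (lerD yP a2)) _.
  by lra.
pose G i b x := \sum_a w a x * B i a b x.
have G_cont i b x : O x -> {for x, continuous (G i b)}.
  move=> Ox; apply: (@Ck_on_cont _ _ 0 O) => //.
  apply: Ck_on_sum => // a; apply: Ck_onM => //; last exact: B_smooth.
  by split => // y; exact: w_cont.
have w_derive i b x : O x -> is_derive x (delta_mx 0 i : 'rV[R]_n) (w b) (G i b x).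
  move=> Ox; apply: is_derive_eps => e e0.
  have H1 : nbhs x O by apply: open_nbhs_nbhs; split.
  have H2 := (continuous_ptP _ _).1 (G_cont i b x Ox) _ e0.
  have : nbhs x (fun y => O y /\ `|G i b x - G i b y| <= e) by apply: filterS2 H1 H2.
  move=> /nbhs_ballP[d /= d0 dP]; exists d => // s sd.
  pose d1 : 'rV[R]_n := delta_mx 0 i.
  have inball u : `|u| <= `|s| -> ball x d (x + u *: d1).
    move=> us; rewrite -ball_normE /= opprD addrA subrr sub0r normrN.
    apply: le_lt_trans sd; apply: le_trans us.
    apply: normr_rV_le => // l; rewrite !mxE normrM ler_piMr //.
    by case: (_ && _); rewrite ?normr1 ?normr0.
  have [Oxs _] := dP _ (inball s (lexx _)).
  have key m : `|w b (x + s *: d1) - w b x - s * G i b x| <=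
      e * `|s| + (4 * c0 + 6 * (N%:R * M * c0) * `|s|) * 2^-1 ^+ m.
    set eps : R := 2^-1 ^+ m.
    have [u us Eu] := @mvt_line _ _ (picard m b) x d1 s
      (fun u us => Ck_on_derivable (picard_Ck1 m b) (dP _ (inball u us)).1).
    have [Oy yP] := dP _ (inball u us); move: Eu Oy yP; set y := x + u *: d1 => Eu Oy yP.
    have h1 := picard_defect m i b Oy; rewrite -/eps in h1.
    have h2 : `|rowmul (picard m) b i y - G i b y| <= N%:R * M * (2 * c0 * eps).
      rewrite /rowmul /G -sumrB; under eq_bigr do rewrite -mulrBl.
      by apply: (rowmul_le _ _ Oy) => a; exact: wP.
    have h3 : `|partiald i (picard m b) y - G i b x| <= 6 * (N%:R * M * c0) * eps + e.
      rewrite distrC in yP.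
      apply: le_trans (ler_distD (rowmul (picard m) b i y) _ _) _.
      apply: le_trans (lerD h1 (ler_distD (G i b y) _ _)) _.
      apply: le_trans (lerD (lexx _) (lerD h2 yP)) _.
      by rewrite addrA lerD2r le_eqVlt; apply/orP; left; apply/eqP; ring.
    have a1 := wP b x m Ox; have a2 := wP b _ m Oxs; rewrite -/eps in a1 a2.
    rewrite distrC in a2.
    have -> : w b (x + s *: d1) - w b x - s * G i b x =
      (w b (x + s *: d1) - picard m b (x + s *: d1)) + (picard m b x - w b x)
      + s * (partiald i (picard m b) y - G i b x).
      rewrite mulrBr -[s * partiald _ _ _]Eu.
      by move: (w b _) (w b x) (picard m b _) (picard m b x) (s * _) => p1 p2 p3 p4 p5;
          ring.
    apply: le_trans (ler_normD _ _) _.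
    apply: le_trans (lerD (ler_normD _ _) (lexx _)) _.
    apply: le_trans (lerD (lerD a2 a1) _) _.
      by rewrite normrM; exact: ler_wpM2l h3.
    by rewrite le_eqVlt; apply/orP; left; apply/eqP; ring.
  apply/ler_addgt0Pr => e' e'0.
  have [m me] := geometric_small (4 * c0 + 6 * (N%:R * M * c0) * `|s|) e'0.
  by apply: le_trans (key m) _; rewrite lerD2l.
exists w; split.
- have wCk m : forall b, Ck_on m O (w b).
    elim: m => [|m IH] b; first by split => // x; exact: w_cont.
    split; first by move=> x; exact: w_cont.
    move=> i; split; first by move=> x Ox;
        exact: (@ex_derive _ _ _ _ _ _ _ (w_derive i b x Ox)).
    apply: (@Ck_on_ext _ _ _ _ (G i b)) => //.
      by move=> x Ox; rewrite /partiald (@derive_val _ _ _ _ _ _ _ (w_derive i b x Ox)).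
    by apply: Ck_on_sum => // a; apply: Ck_onM => //; exact: B_smooth.
  by move=> b m; exact: wCk.
- move=> b; have Ox0 : O x0 by exact: ballxx.
  have pE m : picard m b x0 = w0 b by case: m => //= m; rewrite cone_center addr0.
  apply/eqP; rewrite -subr_eq0 -normr_le0; apply/ler_addgt0Pr => e e0; rewrite add0r.
  have [m me] := geometric_small (2 * c0) e0.
  by apply: le_trans me; rewrite distrC -(pE m); exact: wP.
- move=> x i b Ox; exact: (@derive_val _ _ _ _ _ _ _ (w_derive i b x Ox)).
Qed.

End Frobenius.

(** The radius depends on a bound for B near x0 only, not on the initial value w0;
therefore several solutions can be found on a common ball. *)
Theorem linear_frobenius {R : realType} {n N : nat} (V : set 'rV[R]_n) (x0 : 'rV[R]_n)
    (B : 'I_n -> 'I_N -> 'I_N -> 'rV[R]_n -> R) : open V -> V x0 ->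
  (forall j a b, smooth_on V (B j a b)) ->
  (forall i j a b x, V x ->
    partiald i (B j a b) x + \sum_c B i a c x * B j c b x =
    partiald j (B i a b) x + \sum_c B j a c x * B i c b x) ->
  exists2 r : R, 0 < r & ball x0 r `<=` V /\ forall w0 : 'I_N -> R,
    exists W : 'I_N -> 'rV[R]_n -> R,
    [/\ forall b, smooth_on (ball x0 r) (W b), forall b, W b x0 = w0 b &
     forall x i b, ball x0 r x -> partiald i (W b) x = \sum_a W a x * B i a b x].
Proof.
move=> oV Vx0 sB fB.
(* bounds B at x0 with a margin of 1, hence in a neighbourhood of x0 *)
pose M : R := 1 + \sum_j \sum_a \sum_b `|B j a b x0|.
have le1 j a b : `|B j a b x0| + 1 <= M.
  rewrite /M addrC lerD2l (bigD1 j) //= (bigD1 a) //= (bigD1 b) //=.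
  by rewrite -!addrA lerDl !addr_ge0 // !sumr_ge0 // => *; rewrite ?sumr_ge0 // => *;
      rewrite sumr_ge0.
have M0 : 0 <= M by rewrite addr_ge0 // !sumr_ge0 // => *; rewrite ?sumr_ge0 // => *;
    rewrite sumr_ge0.
have bnd : \forall x \near x0, V x /\ forall jab : 'I_n * 'I_N * 'I_N, `|B jab.1.1
    jab.1.2 jab.2 x| <= M.
  have H1 : nbhs x0 V by apply: open_nbhs_nbhs; split.
  have H2 (jab : 'I_n * 'I_N * 'I_N) : \forall x \near x0, `|B jab.1.1 jab.1.2 jab.2 x|
      <= M.
    case: jab => [[j a] b] /=.
    have H3 := (continuous_ptP _ _).1 (smooth_cont (sB j a b) Vx0) 1 ltr01.
    apply: filterS H3 => x xP; apply: le_trans (le1 j a b).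
    by rewrite -lerBlDl (le_trans (lerB_dist _ _)) // distrC.
  have H3 := @filter_forall _ _ (fun jab x =>
      `|B jab.1.1 jab.1.2 jab.2 x| <= M) _ (nbhs_filter x0) H2.
  by apply: filterS2 H1 H3.
move: bnd => /nbhs_ballP[d /= d0 dP].
pose K : R := n%:R * (2 * (N%:R * M)).
have K0 : 0 <= K by rewrite !mulr_ge0.
pose r := Num.min d (4 * (1 + K))^-1.
have r0 : 0 < r by rewrite lt_min d0 invr_gt0 mulr_gt0 // ltr_wpDr.
have sub : ball x0 r `<=` ball x0 d by apply: le_ball; rewrite ge_min lexx.
exists r => //; split; first by move=> x /sub/dP[].
move=> w0; apply: (@frobenius_ball _ _ _ x0 r M) => //.
- by move=> j a b; apply: smooth_sub (sB j a b) => x /sub/dP[].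
- by move=> j a b x /sub/dP[_ /(_ (j, a, b))].
- have -> : n%:R * r * (2 * (N%:R * M)) = K * r by rewrite /K; ring.
  have rle : r <= (4 * (1 + K))^-1 by rewrite ge_min lexx orbT.
  apply: le_trans (ler_wpM2l K0 rle) _.
  rewrite invfM mulrCA ger_pMr ?invr_gt0 // ler_pdivrMr ?ltr_wpDr // mul1r lerDr //.
- by move=> i j a b x /sub/dP[Vx _]; exact: fB.
Qed.

(** * Calculus of matrix functions *)

Local Opaque partiald.

Section MatrixCalculus.
Context {R : realType} {n : nat} (U : set 'rV[R]_n).
Hypothesis oU : open U.
Implicit Types (x : 'rV[R]_n) (i j : 'I_n).

Definition smooth_mx p q (A : 'rV[R]_n -> 'M[R]_(p, q)) :=
  forall a b, smooth_on U (fun y => A y a b).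

Definition partial_mx p q j (A : 'rV[R]_n -> 'M[R]_(p, q)) x : 'M[R]_(p, q) :=
  \matrix_(a, b) partiald j (fun y => A y a b) x.

Lemma smooth_partial_mx p q j (A : 'rV[R]_n -> 'M[R]_(p, q)) : smooth_mx A ->
    smooth_mx (partial_mx j A).
Proof.
move=> sA a b; apply: smooth_ext (smooth_partial j (sA a b)) => // x _.
by rewrite mxE.
Qed.

Lemma smooth_mxM p q s (A : 'rV[R]_n -> 'M[R]_(p, q)) (B : 'rV[R]_n -> 'M[R]_(q, s)) :
  smooth_mx A -> smooth_mx B -> smooth_mx (fun y => A y *m B y).
Proof.
move=> sA sB a b; apply: (@smooth_ext _ _ _ (fun y => \sum_k A y a k * B y k b)) => //.
  by move=> x _; rewrite mxE.
by apply: smooth_sum => // k; apply: smoothM.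
Qed.

Lemma smooth_mxB p q (A B : 'rV[R]_n -> 'M[R]_(p, q)) :
  smooth_mx A -> smooth_mx B -> smooth_mx (fun y => A y - B y).
Proof.
move=> sA sB a b; apply: smooth_ext (smoothB oU (sA a b) (sB a b)) => // x _.
by rewrite !mxE.
Qed.

Lemma smooth_mx_tr p q (A : 'rV[R]_n -> 'M[R]_(p, q)) :
  smooth_mx A -> smooth_mx (fun y => (A y)^T).
Proof. by move=> sA a b; apply: smooth_ext (sA b a) => // x _; rewrite mxE. Qed.

Lemma smooth_det p (A : 'rV[R]_n -> 'M[R]_p) :
  smooth_mx A -> smooth_on U (fun y => \det (A y)).
Proof.
move=> sA; apply: smooth_sum => // s; apply: smoothM => //; first exact: smooth_cst.
by apply: smooth_prod => // i; exact: sA.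
Qed.

Lemma smooth_mx_inv p (A : 'rV[R]_n -> 'M[R]_p) :
  (forall x, U x -> A x \in unitmx) -> smooth_mx A -> smooth_mx (fun y => invmx (A y)).
Proof.
move=> uA sA a b.
have sadj : smooth_on U (fun y => cofactor (A y) b a).
  apply: smoothM => //; first exact: smooth_cst.
  apply: smooth_det => c d.
  by apply: smooth_ext (sA (lift b c) (lift a d)) => // x _; rewrite !mxE.
have sdet : smooth_on U (fun y => (\det (A y))^-1).
  by apply: smoothV (smooth_det sA) => // x /uA; rewrite unitmxE unitfE.
apply: smooth_ext (smoothM oU sdet sadj) => // x Ux.
by rewrite /invmx uA // !mxE.
Qed.

Lemma partial_mx_ext p q j (A B : 'rV[R]_n -> 'M[R]_(p, q)) x : U x ->
  (forall y, U y -> A y = B y) -> partial_mx j A x = partial_mx j B x.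
Proof.
move=> Ux AB; apply/matrixP => a b; rewrite !mxE; apply: (partiald_on j oU Ux).
by move=> y Uy; rewrite AB.
Qed.

Lemma partial_mxM p q s j (A : 'rV[R]_n -> 'M[R]_(p, q)) (B : 'rV[R]_n -> 'M[R]_(q, s)) x :
  U x -> smooth_mx A -> smooth_mx B ->
  partial_mx j (fun y => A y *m B y) x = partial_mx j A x *m B x + A x *m partial_mx j B x.
Proof.
move=> Ux sA sB; apply/matrixP => a b; rewrite !mxE.
rewrite (@partiald_on _ _ U _ _ (fun y => \sum_k A y a k * B y k b)) //; last first.
  by move=> y _; rewrite mxE.
have dA k := smooth_derivable (i := j) (sA a k) Ux.
have dB k := smooth_derivable (i := j) (sB k b) Ux.
have [|_ ->] := @partiald_sum _ _ _ (index_enum _) j (fun k y => A y a k * B y k b) x.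
  by move=> k; apply: derivableM; [exact: dA|exact: dB].
rewrite -big_split; apply: eq_bigr => k _; rewrite !mxE.
by rewrite partialdM; [rewrite addrC mulrC|exact: dA|exact: dB].
Qed.

Lemma partial_mxB p q j (A B : 'rV[R]_n -> 'M[R]_(p, q)) x : U x -> smooth_mx A ->
    smooth_mx B ->
  partial_mx j (fun y => A y - B y) x = partial_mx j A x - partial_mx j B x.
Proof.
move=> Ux sA sB; apply/matrixP => a b; rewrite !mxE.
rewrite (@partiald_on _ _ U _ _ (fun y => A y a b - B y a b)) //; last first.
  by move=> y _; rewrite !mxE.
by rewrite partialdB; [by []|exact: smooth_derivable (sA a b) Ux|exact:
    smooth_derivable (sB a b) Ux].
Qed.

Lemma partial_mx_tr p q j (A : 'rV[R]_n -> 'M[R]_(p, q)) x :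
  partial_mx j (fun y => (A y)^T) x = (partial_mx j A x)^T.
Proof.
apply/matrixP => a b; rewrite !mxE; congr (partiald j _ x).
by apply/funext => y; rewrite mxE.
Qed.

Lemma partial_mx_cst p q j (A : 'M[R]_(p, q)) x : partial_mx j (fun=> A) x = 0.
Proof. by apply/matrixP => a b; rewrite !mxE; exact: partiald_cst. Qed.

Lemma partial_mx_inv p j (A : 'rV[R]_n -> 'M[R]_p) x : U x ->
  (forall x, U x -> A x \in unitmx) -> smooth_mx A ->
  partial_mx j (fun y => invmx (A y)) x =
      - (invmx (A x) *m partial_mx j A x *m invmx (A x)).
Proof.
move=> Ux uA sA; have sV := smooth_mx_inv uA sA.
have := partial_mxM j Ux sV sA.
rewrite (@partial_mx_ext _ _ _ _ (fun=> 1%:M)) //; last by move=> y Uy; rewrite mulVmx ?uA.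
rewrite partial_mx_cst => /eqP; rewrite eq_sym addr_eq0 => /eqP E.
by rewrite -[LHS](mulmxK (uA x Ux)) E mulNmx.
Qed.

Lemma partial_mxC p q i j (A : 'rV[R]_n -> 'M[R]_(p, q)) x : U x -> smooth_mx A ->
  partial_mx i (partial_mx j A) x = partial_mx j (partial_mx i A) x.
Proof.
move=> Ux sA; apply/matrixP => a b.
have E k l : partial_mx k (partial_mx l A) x a b =
    partiald k (partiald l (fun y => A y a b)) x.
  by rewrite mxE; congr (partiald k _ x); apply/funext => y; rewrite mxE.
apply: etrans (E i j) _; apply: etrans _ (esym (E j i)).
exact: (schwarz i j oU Ux (sA a b 2%N)).
Qed.

End MatrixCalculus.

(** * Christoffel symbols and curvature in matrix form *)

(** Lowering the first index of the curvature: here g, C_j and gi C_j stand for the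
metric, its Christoffel symbols of the first kind and those of the second kind,
dBk and dCk for j-th derivatives and dBj and dCj for k-th ones.  The terms
C_j gi C_k coming from d_j g = C_j + C_j^T cancel against the quadratic terms of
the curvature. *)
Lemma curvature_mx_alg {R : comPzRingType} {n : nat}
  (g gi Cj Ck dBj dBk dCj dCk dgj dgk : 'M[R]_n) :
  g *m gi = 1%:M ->
  g *m dBk = dCk - dgj *m (gi *m Ck) -> g *m dBj = dCj - dgk *m (gi *m Cj) ->
  dgj = Cj + Cj^T -> dgk = Ck + Ck^T ->
  g *m (dBk - dBj + (gi *m Cj) *m (gi *m Ck) - (gi *m Ck) *m (gi *m Cj)) =
  dCk - dCj - (Cj^T *m gi *m Ck - Ck^T *m gi *m Cj).
Proof.
move=> ggi Ek Ej Dj Dk; rewrite {}Dj in Ek; rewrite {}Dk in Ej.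
move: Ek Ej; rewrite mulmxBr mulmxDr mulmxBr => -> ->;
    rewrite !mulmxA ggi !mul1mx !mulmxDl ?mulmxA.
move: (Cj *m gi *m Ck) (Ck *m gi *m Cj) (Cj^T *m gi *m Ck) (Ck^T *m gi *m Cj) => a b c d.
apply/matrixP => s t; rewrite !mxE; ring.
Qed.

Lemma gauss_alg_sum {R : comPzRingType} {n : nat} (a b h P1 P2 Q1 Q2 S1 S2 T1 T2 :
    'M[R]_n) :
  P1 + Q1 = S1 + T1 -> P2 + Q2 = S2 + T2 ->
  a - (P1 + h) - (b - (P2 + h)) - (Q1 - Q2) = a - b - (T1 - T2) - (S1 - S2).
Proof.
rewrite addrC => /(canRL (addrK _)) ->; rewrite addrC => /(canRL (addrK _)) ->.
apply/matrixP => s t; rewrite !mxE; ring.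
Qed.

(** The identities used are C - H^T K = f gi C - H^T S, for the difference of the
Christoffel symbols, and H^T H = g - f. *)
Lemma gauss_alg {R : comPzRingType} {n k : nat}
  (g gi f fi Ci Cm : 'M[R]_n) (H Ki Km Si Sm : 'M[R]_(k, n)) :
  g *m gi = 1%:M -> f *m fi = 1%:M -> gi^T = gi -> f^T = f -> f = g - H^T *m H ->
  Ki = Si + H *m (gi *m Ci) -> Km = Sm + H *m (gi *m Cm) ->
  Ki^T *m Km + (Ci - H^T *m Ki)^T *m fi *m (Cm - H^T *m Km) =
  Si^T *m (1%:M + H *m fi *m H^T) *m Sm + Ci^T *m gi *m Cm.
Proof.
move=> ggi ffi gis fs fE KiE KmE.
have fif : fi *m f = 1%:M by exact: mulmx1C.
have CF C K S : K = S + H *m (gi *m C) -> C - H^T *m K = f *m (gi *m C) - H^T *m S.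
  move=> ->; rewrite fE mulmxBl mulmxDr opprD !mulmxA ggi mul1mx.
  by rewrite addrA addrAC.
rewrite (CF _ _ _ _ KiE) (CF _ _ _ _ KmE).
have -> : (f *m (gi *m Ci) - H^T *m Si)^T = Ci^T *m gi *m f - Si^T *m H.
  by rewrite raddfB /= !trmx_mul trmxK fs gis.
have -> : (Ci^T *m gi *m f - Si^T *m H) *m fi *m (f *m (gi *m Cm) - H^T *m Sm) =
  Ci^T *m gi *m (f *m (gi *m Cm)) - Ci^T *m gi *m H^T *m Sm
  - Si^T *m H *m gi *m Cm + Si^T *m (H *m fi *m H^T) *m Sm.
  rewrite !mulmxBl !mulmxBr -!mulmxA !(mulmxA f fi) ffi !mul1mx !(mulmxA fi f) fif !mul1mx.
  by rewrite opprB addrA addrAC; congr (_ + _); rewrite addrAC.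
have -> : Ki^T = Si^T + Ci^T *m gi *m H^T by rewrite KiE raddfD /= !trmx_mul gis.
rewrite KmE fE.
rewrite !(mulmxDl, mulmxDr, mulmxN, mulNmx) ?mulmx1 !mulmxA.
rewrite -[Ci^T *m gi *m g]mulmxA (mulmx1C ggi) mulmx1.
move: (Si^T *m Sm) (Si^T *m H *m gi *m Cm) (Ci^T *m gi *m H^T *m Sm) (Ci^T *m gi
    *m H^T *m H *m gi *m Cm)
  (Ci^T *m gi *m Cm) (Si^T *m H *m fi *m H^T *m Sm) => a b c d e o.
apply/matrixP => s t; rewrite !mxE; ring.
Qed.

Section Curvature.
Context {R : realType} {n : nat} (U : set 'rV[R]_n).
Hypothesis oU : open U.
Implicit Types (x : 'rV[R]_n) (i j l p : 'I_n) (G F : 'rV[R]_n -> 'M[R]_n).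

(** Christoffel symbols of the first kind; the entry (s, i) is [ij, s]. *)
Definition christoffel1 G j x : 'M[R]_n := \matrix_(s, i) (2^-1 *
  (partiald j (fun y => G y s i) x + partiald i (fun y => G y s j) x
   - partiald s (fun y => G y j i) x)).

(** The entry (l, i) is Gamma^l_{ji}, so that covariant differentiation along the
j-th coordinate acts on row vectors by right multiplication. *)
Definition connection G j x : 'M[R]_n := invmx (G x) *m christoffel1 G j x.

Definition grad k (h : 'I_k -> 'rV[R]_n -> R) x : 'M[R]_(k, n) :=
  \matrix_(al, a) partiald a (h al) x.

Lemma christoffelE G l i j x : christoffel G l i j x = connection G i x l j.
Proof.
rewrite /christoffel /connection mxE mulr_sumr; apply: eq_bigr => s _; rewrite mxE.
by rewrite mulrCA.
Qed.

Definition symm_on G := forall x, U x -> (G x)^T = G x.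
Definition unit_on G := forall x, U x -> G x \in unitmx.

Section Metric.
Variable G : 'rV[R]_n -> 'M[R]_n.
Hypothesis sG : smooth_mx U G.
Hypothesis symG : symm_on G.
Hypothesis uG : unit_on G.

Let partial_sym i a b x : U x ->
    partiald i (fun y => G y a b) x = partiald i (fun y => G y b a) x.
Proof.
move=> Ux; apply: partiald_on Ux _ => // y Uy; by rewrite -[in LHS]symG // mxE.
Qed.

Lemma christoffel1_sym s i j x : U x -> christoffel1 G j x s i = christoffel1 G i x s j.
Proof.
move=> Ux; rewrite !mxE (partial_sym _ j i Ux).
by rewrite [partiald j _ _ + _]addrC.
Qed.

Lemma connection_sym l i j x : U x -> connection G j x l i = connection G i x l j.
Proof. by move=> Ux; rewrite !mxE; apply: eq_bigr => s _; rewrite christoffel1_sym. Qed.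

Lemma christoffel1_tr j x : U x ->
    christoffel1 G j x + (christoffel1 G j x)^T = partial_mx j G x.
Proof.
move=> Ux; apply/matrixP => a b; rewrite !mxE.
rewrite (partial_sym j b a Ux) (partial_sym b j a Ux) (partial_sym a j b Ux).
by move: (partiald _ _ _) (partiald _ _ _) (partiald _ _ _) => u v w; field.
Qed.

Lemma smooth_christoffel1 j : smooth_mx U (christoffel1 G j).
Proof.
move=> a b; apply: (@smooth_ext _ _ _ (fun x => 2^-1 *
  (partiald j (fun y => G y a b) x + partiald b (fun y => G y a j) x
   - partiald a (fun y => G y j b) x))) => //; first by move=> x _; rewrite mxE.
apply: smoothM => //; first exact: smooth_cst.
by apply: smoothB => //; [apply: smoothD => //|]; exact: smooth_partial.
Qed.

Lemma smooth_connection j : smooth_mx U (connection G j).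
Proof. by apply: smooth_mxM => //; [exact: smooth_mx_inv|exact: smooth_christoffel1]. Qed.

(** The entry (l, i) is R^l_{ijk}. *)
Definition curvature_mx j (k : 'I_n) x : 'M[R]_n :=
  partial_mx j (connection G k) x - partial_mx k (connection G j) x
      + connection G j x *m connection G k x - connection G k x *m connection G j x.

Lemma riemann_upE l i j (k : 'I_n) x : U x ->
    riemann_up G l i j k x = curvature_mx j k x l i.
Proof.
move=> Ux; rewrite /riemann_up /curvature_mx !mxE.
have dE a b : partiald a (christoffel G l i b) x =
    partiald a (fun y => connection G b y l i) x.
  by apply: (partiald_on a oU Ux) => y Uy; rewrite christoffelE connection_sym.
have mE a b : \sum_s christoffel G l a s x * christoffel G s i b x =
    \sum_s connection G a x l s * connection G b x s i.
  by apply: eq_bigr => s _; rewrite 2!christoffelE (connection_sym s b i Ux).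
by rewrite (dE j k) (dE k j) (mE j k) (mE k j).
Qed.

Lemma riemann_mx p i j (k : 'I_n) x : U x ->
    riemann G p i j k x = (G x *m curvature_mx j k x) p i.
Proof.
by move=> Ux; rewrite /riemann mxE; apply: eq_bigr => l _; rewrite riemann_upE.
Qed.

Lemma connection_lower j x : U x -> G x *m connection G j x = christoffel1 G j x.
Proof. by move=> Ux; rewrite /connection mulKVmx ?uG. Qed.

Lemma curvature_mx_lower j (k : 'I_n) x : U x -> G x *m curvature_mx j k x =
  partial_mx j (christoffel1 G k) x - partial_mx k (christoffel1 G j) x
  - ((christoffel1 G j x)^T *m invmx (G x) *m christoffel1 G k x
      - (christoffel1 G k x)^T *m invmx (G x) *m christoffel1 G j x).
Proof.
move=> Ux.
have E i l : G x *m partial_mx i (connection G l) x =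
    partial_mx i (christoffel1 G l) x - partial_mx i G x *m connection G l x.
  rewrite -(@partial_mx_ext _ _ _ oU _ _ i
      (fun y => G y *m connection G l y) (christoffel1 G l)) //; last first.
    by move=> y Uy; rewrite connection_lower.
  by rewrite (partial_mxM oU i Ux sG (smooth_connection l)) addrC addKr.
exact: (curvature_mx_alg (mulmxV (uG Ux)) (E j k) (E k j) (esym (christoffel1_tr j Ux))
    (esym (christoffel1_tr k Ux))).
Qed.

End Metric.

Lemma smooth_grad k (h : 'I_k -> 'rV[R]_n -> R) : (forall al, smooth_on U (h al)) ->
  smooth_mx U (grad h).
Proof.
move=> sh al a; apply: smooth_ext (smooth_partial a (sh al)) => // x _.
by rewrite mxE.
Qed.

Lemma partial_mx_gradE k (h : 'I_k -> 'rV[R]_n -> R) j x al a :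
  partial_mx j (grad h) x al a = partiald j (partiald a (h al)) x.
Proof.
rewrite mxE; congr (partiald j _ x).
by apply/funext => y; rewrite mxE.
Qed.

Lemma partial_mx_gradC k (h : 'I_k -> 'rV[R]_n -> R) j x al a : U x ->
  (forall al, smooth_on U (h al)) ->
      partial_mx j (grad h) x al a = partial_mx a (grad h) x al j.
Proof.
move=> Ux sh; apply: etrans (partial_mx_gradE _ _ _ _ _) _.
apply: etrans _ (esym (partial_mx_gradE _ _ _ _ _)).
exact: (schwarz j a oU Ux (sh al 2%N)).
Qed.

(** For a form sum_al h_s h_i the three derivatives in [ij, s] contain six products of a
first and a second derivative, of which four cancel. *)
Lemma christoffel1_gram k (h : 'I_k -> 'rV[R]_n -> R) j x : U x ->
  (forall al, smooth_on U (h al)) ->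
  christoffel1 (fun y => (grad h y)^T *m grad h y) j x =
      (grad h x)^T *m partial_mx j (grad h) x.
Proof.
move=> Ux sh; have sg := smooth_grad sh.
have trE p q (A : 'M[R]_(p, q)) a b : A^T a b = A b a by rewrite mxE.
pose D i : 'M[R]_(k, n) := partial_mx i (grad h) x.
have DC i al a : D i al a = D a al i by exact: partial_mx_gradC.
have E i a b : partiald i (fun y => ((grad h y)^T *m grad h y) a b) x =
    \sum_al (D i al a * grad h x al b + grad h x al a * D i al b).
  have := partial_mxM oU i Ux (smooth_mx_tr oU sg) sg.
  rewrite partial_mx_tr -/(D i) => /matrixP/(_ a b); rewrite [LHS]mxE => ->.
  rewrite !mxE -big_split; apply: eq_bigr => al _ /=.
  by rewrite ?trE ?mxE.
rewrite -/(D j); clearbody D.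
apply/matrixP => s i; rewrite mxE !E mxE -big_split -sumrB mulr_sumr.
apply: eq_bigr => al _ /=; rewrite [in RHS]mxE.
rewrite (DC i al s) (DC i al j) (DC j al s).
move: (D _ _ _) (D _ _ _) (D _ _ _) => u v w.
move: (grad h x al i) (grad h x al j) (grad h x al s) => a b c.
by field.
Qed.

Lemma christoffel1B G G' j x : U x -> smooth_mx U G -> smooth_mx U G' ->
  christoffel1 (fun y => G y - G' y) j x = christoffel1 G j x - christoffel1 G' j x.
Proof.
move=> Ux sG sG'.
have E i a b : partiald i (fun y => (G y - G' y) a b) x =
  partiald i (fun y => G y a b) x - partiald i (fun y => G' y a b) x.
  by have /matrixP/(_ a b) := partial_mxB oU i Ux sG sG'; rewrite !mxE.
apply/matrixP => s i; rewrite !mxE !E -mulrBr; congr (_ * _).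
move: (partiald _ _ _) (partiald _ _ _) (partiald _ _ _) => u v w.
move: (partiald _ _ _) (partiald _ _ _) (partiald _ _ _) => u' v' w'.
by ring.
Qed.

(** * The Gauss equation *)

Section Gauss.
Variables (k : nat) (G : 'rV[R]_n -> 'M[R]_n) (h : 'I_k -> 'rV[R]_n -> R).
Hypothesis sG : smooth_mx U G.
Hypothesis symG : symm_on G.
Hypothesis uG : unit_on G.
Hypothesis sh : forall al, smooth_on U (h al).
Let F x := G x - (grad h x)^T *m grad h x.
Hypothesis uF : unit_on F.

Definition hessian_mx j x : 'M[R]_(k, n) :=
    partial_mx j (grad h) x - grad h x *m connection G j x.
Definition cogram_mx x : 'M[R]_k := 1%:M - grad h x *m invmx (G x) *m (grad h x)^T.

Lemma hessianE al a b x : U x -> hessian G (h al) a b x = hessian_mx b x al a.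
Proof.
move=> Ux; rewrite /hessian /hessian_mx mxE partial_mx_gradE; congr (_ + _).
rewrite mxE mxE; congr (- _); apply: eq_bigr => s _.
by rewrite christoffelE (connection_sym symG _ _ _ Ux) mulrC [grad h x al s]mxE.
Qed.

Lemma reduced_smooth : smooth_mx U F.
Proof.
have sg := smooth_grad sh; apply: smooth_mxB => //.
by apply: smooth_mxM => //; exact: smooth_mx_tr.
Qed.

Lemma reduced_sym : symm_on F.
Proof. by move=> x Ux; rewrite /F linearB /= trmx_mul trmxK symG. Qed.

(** The Woodbury identity for F = G - H^T H. *)
Lemma cogram_mx_inv x : U x ->
    invmx (cogram_mx x) = 1%:M + grad h x *m invmx (F x) *m (grad h x)^T.
Proof.
move=> Ux; set H := grad h x; set X := _ + _.
have E : cogram_mx x *m X = 1%:M.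
  rewrite /cogram_mx -/H /X mulmxBl mul1mx mulmxDr mulmx1.
  have -> : H *m invmx (G x) *m H^T *m (H *m invmx (F x) *m H^T) =
     H *m invmx (G x) *m (H^T *m H) *m invmx (F x) *m H^T by rewrite !mulmxA.
  have -> : H^T *m H = G x - F x by rewrite /F opprB addrC subrK.
  rewrite mulmxBr -[H *m _ *m G x]mulmxA mulVmx ?uG // mulmx1.
  rewrite !mulmxBl -[H *m invmx (G x) *m F x *m _]mulmxA mulmxV ?uF // mulmx1.
  by rewrite [_ + (_ - _)]addrC subrK addrK.
have [u _] := mulmx1_unit E.
by rewrite -[RHS](mulKmx u) E mulmx1.
Qed.

(** The derivatives of the Christoffel symbols of F and of G differ by K_j^T K_l,
antisymmetrized in j and l, where K_j = d_j H; the second derivatives of H cancel.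
What remains is [gauss_alg]. *)
Lemma gauss_equation j l x : U x ->
  F x *m curvature_mx F j l x = G x *m curvature_mx G j l x
  - ((hessian_mx j x)^T *m invmx (cogram_mx x) *m hessian_mx l x
     - (hessian_mx l x)^T *m invmx (cogram_mx x) *m hessian_mx j x).
Proof.
move=> Ux; have sg := smooth_grad sh; set H := grad h x.
have sF := reduced_smooth; have symF := reduced_sym.
have sgg : smooth_mx U (fun y => (grad h y)^T *m grad h y).
  by apply: smooth_mxM => //; exact: smooth_mx_tr.
have chrF i y : U y -> christoffel1 F i y =
    christoffel1 G i y - (grad h y)^T *m partial_mx i (grad h) y.
  by move=> Uy; rewrite christoffel1B // christoffel1_gram.
have sK i : smooth_mx U (fun y => (grad h y)^T *m partial_mx i (grad h) y).
  by apply: smooth_mxM; [|exact: smooth_mx_tr|exact: smooth_partial_mx].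
rewrite !curvature_mx_lower //.
have dchr i m : partial_mx i (christoffel1 F m) x = partial_mx i (christoffel1 G m) x
   - ((partial_mx i (grad h) x)^T *m partial_mx m (grad h) x
       + H^T *m partial_mx i (partial_mx m (grad h)) x).
  have E : partial_mx i (christoffel1 F m) x = partial_mx i
      (fun y => christoffel1 G m y - (grad h y)^T *m partial_mx m (grad h) y) x.
    by apply: (partial_mx_ext oU i Ux) => y Uy; exact: chrF.
  have sC : smooth_mx U (christoffel1 G m) by exact: smooth_christoffel1.
  have E2 := partial_mxB oU i Ux sC (sK m).
  apply: etrans E _; apply: etrans E2 _.
  congr (_ - _).
  apply: etrans (partial_mxM oU i Ux (smooth_mx_tr oU sg) (smooth_partial_mx oU m sg)) _.
  by rewrite partial_mx_tr.
rewrite (dchr j l).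
rewrite (dchr l j).
rewrite (chrF j x Ux).
rewrite (chrF l x Ux).
rewrite -/H.
rewrite (partial_mxC oU l j Ux sg).
have symGi : (invmx (G x))^T = invmx (G x) by rewrite trmx_inv symG.
have KE i : partial_mx i (grad h) x =
    hessian_mx i x + H *m (invmx (G x) *m christoffel1 G i x).
  by rewrite /hessian_mx subrK.
have main i m := gauss_alg (mulmxV (uG Ux)) (mulmxV (uF Ux)) symGi (symF x Ux) (erefl
    _) (KE i) (KE m).
have E1 := main j l; have E2 := main l j; rewrite -/H -cogram_mx_inv // in E1 E2.
exact: gauss_alg_sum E1 E2.
Qed.

End Gauss.

End Curvature.

(** * Positive definite matrices *)

Section PosDef.
Context {R : realType}.

Lemma posdef_unit n (A : 'M[R]_n) : posdefmx A -> A \in unitmx.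
Proof.
move=> pA; rewrite -row_free_unit -kermx_eq0; apply/negP => /negP/rowV0Pn[v].
move=> /sub_kermxP vA0 v0; have := pA v v0.
by rewrite vA0 mul0mx mxE ltxx.
Qed.

Lemma posdef_gram m n (J : 'M[R]_(m, n)) : (forall v : 'rV[R]_n, J *m v^T = 0 -> v = 0) ->
  posdefmx (J^T *m J).
Proof.
move=> Jinj v v0; rewrite !mulmxA -mulmxA.
have -> : v *m J^T = (J *m v^T)^T by rewrite trmx_mul trmxK.
set w := J *m v^T; rewrite mxE.
have E : \sum_j w^T 0 j * w j 0 = \sum_j w j 0 ^+ 2.
  by apply: eq_bigr => j _; rewrite mxE expr2.
rewrite E lt_def sumr_ge0 ?andbT => [|j _]; last exact: sqr_ge0.
apply/eqP => /psumr_eq0P w0; case/eqP: v0; apply: Jinj.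
apply/matrixP => i j; rewrite ord1 [RHS]mxE; apply/eqP.
by rewrite -(sqrf_eq0 (w i 0)); apply/eqP; apply: w0 => // k _; exact: sqr_ge0.
Qed.

(** Cholesky decomposition: split off the first row and column and apply induction to
the Schur complement S. *)
Lemma posdef_sqrt n (A : 'M[R]_n) : A^T = A -> posdefmx A ->
  exists L : 'M[R]_n, L^T *m L = A.
Proof.
elim: n A => [|n IH] A sA pA.
  by exists 0; apply/matrixP => -[].
move: A sA pA; rewrite -[n.+1]/(1 + n)%N => A sA pA.
pose a := A 0 0; pose b : 'rV[R]_n := ursubmx A; pose D : 'M[R]_n := drsubmx A.
have AE : A = block_mx a%:M b b^T D.
  rewrite -[LHS]submxK; congr block_mx.
    by rewrite [LHS]mx11_scalar !mxE; congr (A _ _)%:M; apply/val_inj.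
  by rewrite trmx_ursub sA.
have a0 : 0 < a.
  pose e : 'rV[R]_(1 + n) := row_mx (1%:M : 'M[R]_1) 0.
  have := pA e; rewrite /e AE tr_row_mx mul_row_block mul_row_col.
  rewrite trmx0 mulmx0 addr0 mul0mx addr0 trmx1 mulmx1 mul1mx mxE eqxx mulr1n; apply.
  apply/negP => /eqP/rowP/(_ 0); rewrite !mxE; case: splitP => // i _.
  by rewrite mxE ord1 eqxx => /eqP; rewrite oner_eq0.
pose S := D - a^-1 *: (b^T *m b).
have sD : D^T = D by rewrite trmx_drsub sA.
have sS : S^T = S by rewrite /S raddfB /= sD linearZ /= trmx_mul trmxK.
have pS : posdefmx S.
  move=> v v0.
  (* chosen so that A maps the vector (c, v) to one whose first entry is 0 *)
  pose c := - (a^-1 *: (v *m b^T)).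
  have vn0 : row_mx c v != 0.
    by apply: contra v0 => /eqP; rewrite -row_mx0 => /eq_row_mx[_ ->].
  have := pA _ vn0; rewrite AE tr_row_mx mul_row_block mul_row_col.
  have -> : c *m a%:M + v *m b^T = 0.
    by rewrite mul_mx_scalar /c scalerN scalerA mulfV ?gt_eqF // scale1r addNr.
  rewrite mul0mx add0r; suff -> : c *m b + v *m D = v *m S by [].
  by rewrite /S mulmxBr addrC /c mulNmx -scalemxAl -scalemxAr mulmxA.
have [L LE] := IH S sS pS.
pose s := Num.sqrt a; have s0 : s != 0 by rewrite gt_eqF // sqrtr_gt0.
have ss : s * s = a by rewrite -expr2 sqr_sqrtr // ltW.
exists (block_mx s%:M (s^-1 *: b) 0 L).
rewrite tr_block_mx mulmx_block AE trmx0 !mul0mx !mulmx0 tr_scalar_mx !addr0.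
congr block_mx.
- by rewrite -scalar_mxM ss.
- by rewrite mul_scalar_mx scalerA mulfV // scale1r.
- by rewrite mul_mx_scalar linearZ /= scalerA mulfV // scale1r.
- have -> : (s^-1 *: b)^T = s^-1 *: b^T by rewrite linearZ.
  rewrite LE /S -scalemxAl -scalemxAr scalerA -invfM ss.
  by rewrite addrCA subrr addr0.
Qed.

End PosDef.

(** * Flat metrics *)

Lemma flat_alg {R : comUnitRingType} {n : nat} (a b c H : 'M[R]_n) : H \in unitmx ->
  a^T *m b + c - (b^T *m a + c) -
   ((H^T *m a)^T *m invmx (H^T *m H) *m (H^T *m b)
    - (H^T *m b)^T *m invmx (H^T *m H) *m (H^T *m a)) = 0.
Proof.
move=> uH; have uT : H^T \in unitmx by rewrite unitmx_tr.
have uF : H^T *m H \in unitmx by rewrite unitmx_mul uT.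
have -> : invmx (H^T *m H) = invmx H *m invmx H^T.
  have E : H^T *m H *m (invmx H *m invmx H^T) = 1%:M.
    by rewrite mulmxA mulmxK // mulmxV.
  by rewrite -[RHS](mulKmx uF) E mulmx1.
have K u w : (H^T *m u)^T *m (invmx H *m invmx H^T) *m (H^T *m w) = u^T *m w.
  by rewrite trmx_mul trmxK -!mulmxA (mulKVmx uH) mulKmx.
by rewrite !K opprD addrACA subrr addr0 subrr.
Qed.

Section Flat.
Context {R : realType} {n : nat} (U : set 'rV[R]_n).
Hypothesis oU : open U.
Implicit Types (x : 'rV[R]_n) (i j l p : 'I_n) (G F : 'rV[R]_n -> 'M[R]_n).

Lemma christoffel1_ext F G j x : U x -> (forall y, U y -> F y = G y) ->
    christoffel1 F j x = christoffel1 G j x.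
Proof.
move=> Ux FG; apply/matrixP => s i; rewrite !mxE.
have E l a b : partiald l (fun y => F y a b) x = partiald l (fun y => G y a b) x.
  by apply: (partiald_on l oU Ux) => y Uy; rewrite FG.
by rewrite (E j s i) (E i s j) (E s j i).
Qed.

Lemma connection_ext F G j x : U x -> (forall y, U y -> F y = G y) ->
    connection F j x = connection G j x.
Proof. by move=> Ux FG; rewrite /connection (christoffel1_ext j Ux FG) FG. Qed.

Lemma curvature_mx_ext F G j l x : U x -> (forall y, U y -> F y = G y) ->
  curvature_mx F j l x = curvature_mx G j l x.
Proof.
move=> Ux FG; rewrite /curvature_mx (connection_ext j Ux FG) (connection_ext l Ux FG).
have E a b : partial_mx a (connection F b) x = partial_mx a (connection G b) x.
  by apply: (partial_mx_ext oU a Ux) => y Uy; exact: connection_ext.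
by rewrite (E j l) (E l j).
Qed.

(** The Christoffel symbols of the second kind are J^-1 d_j J, with J the Jacobian
matrix of h; everything cancels once the second derivatives of J commute. *)
Lemma flat_gram (h : 'I_n -> 'rV[R]_n -> R) j l x : U x ->
  (forall al, smooth_on U (h al)) -> unit_on U (grad h) ->
  curvature_mx (fun y => (grad h y)^T *m grad h y) j l x = 0.
Proof.
move=> Ux sh uh; set F := fun y => _; have sg := smooth_grad oU sh.
have sF : smooth_mx U F by apply: smooth_mxM => //; exact: smooth_mx_tr.
have symF : symm_on U F by move=> y Uy; rewrite /F trmx_mul trmxK.
have uF : unit_on U F by move=> y Uy; rewrite /F unitmx_mul unitmx_tr uh.
have chrF i y : U y -> christoffel1 F i y = (grad h y)^T *m partial_mx i (grad h) y.
  by move=> Uy; exact: (christoffel1_gram oU i Uy sh).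
have dchr i m : partial_mx i (christoffel1 F m) x =
   (partial_mx i (grad h) x)^T *m partial_mx m (grad h) x
       + (grad h x)^T *m partial_mx i (partial_mx m (grad h)) x.
  have E : partial_mx i (christoffel1 F m) x =
      partial_mx i (fun y => (grad h y)^T *m partial_mx m (grad h) y) x.
    by apply: (partial_mx_ext oU i Ux) => y Uy; exact: chrF.
  apply: etrans E _; apply: etrans (partial_mxM oU i Ux (smooth_mx_tr oU sg)
      (smooth_partial_mx oU m sg)) _.
  by rewrite partial_mx_tr.
have := curvature_mx_lower oU sF symF uF j l Ux.
rewrite (dchr j l) (dchr l j) (chrF j x Ux) (chrF l x Ux) (partial_mxC oU l j Ux sg).
rewrite (flat_alg _ _ _ (uh x Ux)) => E.
by rewrite -[LHS](mulKmx (uF x Ux)) E mulmx0.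
Qed.

End Flat.

Lemma partial0_const {R : realType} {n : nat} (x0 : 'rV[R]_n) (r : R)
    (f : 'rV[R]_n -> R) x :
  ball x0 r x -> Ck_on 1 (ball x0 r) f ->
  (forall i y, ball x0 r y -> partiald i f y = 0) -> f x = f x0.
Proof.
move=> Ox Cf f0; pose v := x - x0.
have seg (s : R) : `|s| <= `|1 : R| -> ball x0 r (x0 + s *: v).
  rewrite normr1 -!ball_normE /= => s1; rewrite opprD addNKr normrN normrZ.
  move: Ox; rewrite -ball_normE /= distrC; apply: le_lt_trans.
  by rewrite ler_piMl.
have D (s : R) (s1 : `|s| <= `|1 : R|) := C1_is_diff_on (ball_open x0 r) (seg s s1) Cf.
have [s s1] := @mvt_line _ _ f x0 v 1
    (fun s s1 => diff_derivable (@ex_diff _ _ _ _ _ _ _ (D s s1))).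
have [d1 d2] := D s s1.
rewrite (deriveE v d1) d2 big1 => [|i _]; last by rewrite f0 ?mulr0 //; exact: seg.
by rewrite mulr0 scale1r /v [x0 + _]addrC subrK => /eqP; rewrite subr_eq0 => /eqP.
Qed.

(** The derivative of w f^-1 w^T vanishes when that of w is w C and that of f is
f C + (f C)^T. *)
Lemma parallel_gram_alg {R : comUnitRingType} {n m : nat} (f C : 'M[R]_n) (w :
    'M[R]_(m, n)) :
  f \in unitmx -> f^T = f ->
  (w *m C *m invmx f + w *m - (invmx f *m (f *m C + (f *m C)^T) *m invmx f)) *m w^T
   + w *m invmx f *m (w *m C)^T = 0.
Proof.
move=> uf fs.
have -> : invmx f *m (f *m C + (f *m C)^T) *m invmx f = C *m invmx f + invmx f *m C^T.
  rewrite mulmxDr mulmxDl (mulKmx uf) trmx_mul fs; congr (_ + _).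
  by rewrite -!mulmxA mulmxV // mulmx1.
rewrite trmx_mul mulmxN mulmxDr !mulmxA opprD addrA subrr sub0r mulNmx.
by rewrite addNr.
Qed.

Section FlatCoordinates.
Context {R : realType} {n : nat} (U : set 'rV[R]_n).
Context (F : 'rV[R]_n -> 'M[R]_n) (x0 : 'rV[R]_n).
Hypothesis oU : open U.
Hypothesis Ux0 : U x0.
Hypothesis sF : smooth_mx U F.
Hypothesis symF : symm_on U F.
Hypothesis posF : forall x, U x -> posdefmx (F x).
Hypothesis flatF : forall j l x, U x -> curvature_mx F j l x = 0.

Let uF : unit_on U F. Proof. by move=> x Ux; exact: posdef_unit (posF Ux). Qed.

(** The system d_j u = w_j, d_j w_i = Gamma^l_{ji} w_l for a row vector (u, w):
index 0 stands for u, and index i + 1 for w_i. *)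
Let B (j : 'I_n) (a b : 'I_n.+1) (y : 'rV[R]_n) : R :=
  match unlift ord0 a, unlift ord0 b with
  | Some l, Some i => connection F j y l i
  | Some l, None => (l == j)%:R
  | None, _ => 0
  end.

Let B0 j b y : B j ord0 b y = 0. Proof. by rewrite /B unlift_none. Qed.
Let B1 j l y : B j (lift ord0 l) ord0 y = (l == j)%:R.
Proof. by rewrite /B liftK unlift_none. Qed.
Let B2 j l i y : B j (lift ord0 l) (lift ord0 i) y = connection F j y l i.
Proof. by rewrite /B !liftK. Qed.

Let B_smooth j a b : smooth_on U (B j a b).
Proof.
rewrite /B; case: (unlift ord0 a) => [l|]; last exact: smooth_cst.
case: (unlift ord0 b) => [i|]; last exact: smooth_cst.
exact: smooth_connection.
Qed.

Let B_flat i j a b x : U x ->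
  partiald i (B j a b) x + \sum_c B i a c x * B j c b x =
  partiald j (B i a b) x + \sum_c B j a c x * B i c b x.
Proof.
move=> Ux.
case: (unliftP ord0 a) => [l|] ->; last first.
  have E k m : partiald k (B m ord0 b) x = 0.
    by apply: etrans (partiald_cst k 0 x); apply: (partiald_on k oU Ux) => y _; exact: B0.
  rewrite (E i j) (E j i); congr (_ + _); apply: eq_bigr => c _.
  by rewrite B0 mul0r B0 mul0r.
case: (unliftP ord0 b) => [m|] ->; last first.
  have E k q : partiald k (B q (lift ord0 l) ord0) x = 0.
    by apply: etrans (partiald_cst k (l == q)%:R x);
        apply: (partiald_on k oU Ux) => y _; exact: B1.
  have S k q : \sum_c B k (lift ord0 l) c x * B q c ord0 x = connection F k x l q.
    rewrite big_ord_recl B0 mulr0 add0r (bigD1 q) //= B2 B1 eqxx mulr1 big1 ?addr0 //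
        => c /negbTE cq.
    by rewrite B1 cq mulr0.
  by rewrite (E i j) (E j i) (S i j) (S j i) (connection_sym oU symF _ _ _ Ux).
have E k q : partiald k (B q (lift ord0 l) (lift ord0 m)) x =
    partial_mx k (connection F q) x l m.
  by rewrite mxE; apply: (partiald_on k oU Ux) => y _; exact: B2.
have S k q : \sum_c B k (lift ord0 l) c x * B q c (lift ord0 m) x =
    (connection F k x *m connection F q x) l m.
  rewrite big_ord_recl B0 mulr0 add0r mxE; apply: eq_bigr => c _.
  by rewrite B2 B2.
rewrite (E i j) (E j i) (S i j) (S j i).
have alg (a1 a2 a3 a4 : 'M[R]_n) : a1 - a2 + a3 - a4 = 0 ->
    a1 l m + a3 l m = a2 l m + a4 l m.
  move=> /matrixP/(_ l m); rewrite !mxE => H.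
  by apply/eqP; rewrite -subr_eq0 -{}H opprD addrACA addrA.
exact: alg (flatF i j Ux).
Qed.

(** Solve the system for n initial values w(x0), the rows of a square root of F(x0);
then w F^-1 w^T keeps its initial value 1. *)
Theorem flat_coordinates : exists2 r : R, 0 < r & ball x0 r `<=` U /\
  exists v : 'I_n -> 'rV[R]_n -> R, (forall t, smooth_on (ball x0 r) (v t)) /\
    forall x, ball x0 r x -> (grad v x)^T *m grad v x = F x.
Proof.
have [r r0 [OU WP]] := linear_frobenius oU Ux0 B_smooth B_flat.
exists r => //; split => //; set O := ball x0 r in OU WP *.
have oO : open O by exact: ball_open.
have Ox0 : O x0 by exact: ballxx.
have [L LE] := posdef_sqrt (symF Ux0) (posF Ux0).
have /choice[W {}WP] : forall t : 'I_n, exists W : 'I_n.+1 -> 'rV[R]_n -> R,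
    [/\ forall b, smooth_on O (W b),
     forall b, W b x0 = (if unlift ord0 b is Some l then L t l else 0) &
     forall x i b, O x -> partiald i (W b) x = \sum_a W a x * B i a b x].
  by move=> t; exact: WP.
exists (fun t => W t ord0).
have sW t b : smooth_on O (W t b) by have [+ _ _] := WP t; apply.
have W0 t l : W t (lift ord0 l) x0 = L t l by have [_ -> _] := WP t; rewrite liftK.
have dW0 t i x : O x -> partiald i (W t ord0) x = W t (lift ord0 i) x.
  move=> Ox; have [_ _ -> //] := WP t.
  rewrite big_ord_recl B0 mulr0 add0r (bigD1 i) //= B1 eqxx mulr1 big1 ?addr0 // =>
      c /negbTE ci.
  by rewrite B1 ci mulr0.
have dW1 t i j x : O x -> partiald j (W t (lift ord0 i)) x =
    \sum_l W t (lift ord0 l) x * connection F j x l i.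
  move=> Ox; have [_ _ -> //] := WP t.
  by rewrite big_ord_recl B0 mulr0 add0r; apply: eq_bigr => c _; rewrite B2.
split=> [t|]; first exact: sW.
pose Om x : 'M[R]_n := \matrix_(t, l) W t (lift ord0 l) x.
have gradE x : O x -> grad (fun t => W t ord0) x = Om x.
  by move=> Ox; apply/matrixP => t a; rewrite !mxE dW0.
have sOm : smooth_mx O Om.
  by move=> t l; apply: smooth_ext (sW t (lift ord0 l)) => // x _; rewrite mxE.
have dOm j x : O x -> partial_mx j Om x = Om x *m connection F j x.
  move=> Ox; apply/matrixP => t i; rewrite [LHS]mxE [RHS]mxE.
  apply: etrans (_ : partiald j (W t (lift ord0 i)) x = _).
    by apply: (partiald_on j oO Ox) => y _; rewrite mxE.
  by rewrite dW1 //; apply: eq_bigr => l _; congr (_ * _); rewrite mxE.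
have sFO : smooth_mx O F by move=> a b; apply: smooth_sub (sF a b).
have uFO : unit_on O F by move=> y /OU; exact: uF.
have sFi := smooth_mx_inv oO uFO sFO.
pose P x := Om x *m invmx (F x) *m (Om x)^T.
have sP : smooth_mx O P.
  apply: smooth_mxM => //; last exact: smooth_mx_tr.
  exact: smooth_mxM.
have dP j x : O x -> partial_mx j P x = 0.
  move=> Ox.
  have E1 := partial_mxM oO j Ox (smooth_mxM oO sOm sFi) (smooth_mx_tr oO sOm).
  have E2 := partial_mxM oO j Ox sOm sFi.
  have E3 := partial_mx_inv oO j Ox uFO sFO.
  apply: etrans E1 _; rewrite E2 E3 partial_mx_tr dOm //.
  rewrite -(christoffel1_tr oU symF j (OU _ Ox)) -(connection_lower uF j (OU _ Ox)).
  by apply: parallel_gram_alg; [exact: uFO|apply: symF; exact: OU].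
have P0 : P x0 = 1%:M.
  have -> : P x0 = L *m invmx (F x0) *m L^T.
    by rewrite /P; have -> : Om x0 = L by apply/matrixP => t l; rewrite mxE W0.
  have uFx := uF Ux0; rewrite -LE in uFx *.
  have uL : L \in unitmx by move: uFx; rewrite unitmx_mul => /andP[].
  by apply: mulmx1C; rewrite mulmxA mulmxV.
move=> x Ox; rewrite gradE //.
have P1 : P x = 1%:M.
  rewrite -P0; apply/matrixP => s t.
  apply: (partial0_const Ox (sP s t 1%N)) => i y Oy.
  by have /matrixP/(_ s t) := dP i y Oy; rewrite mxE [RHS]mxE.
have uf : F x \in unitmx by exact: uFO.
have := P1; rewrite /P -mulmxA => /mulmx1C; rewrite -mulmxA => E.
by rewrite -[LHS](mulKVmx uf) E mulmx1.
Qed.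

End FlatCoordinates.

(** * Charts *)

Lemma complement_inj {n k : nat} (s : 'I_n -> 'I_(n + k)) : injective s ->
  exists tau : 'I_k -> 'I_(n + k), forall (V : nmodType) (X : 'I_(n + k) -> V),
    \sum_t X t = \sum_i X (s i) + \sum_j X (tau j).
Proof.
move=> inj_s; pose A : {set 'I_(n + k)} := imset s (mem 'I_n).
have cA : #|A| = n by rewrite card_imset // card_ord.
have cC : k = #|~: A| by rewrite cardsCs finset.setCK cA card_ord addKn.
exists (fun j => enum_val (cast_ord cC j)) => V X.
rewrite (bigID (mem A)) /=; congr (_ + _).
  by rewrite big_imset /= => [|i j _ _]; [apply: eq_bigl|exact: inj_s].
rewrite (eq_bigl (mem (~: A))) => [|t]; last by rewrite /= inE.
rewrite big_enum_val (reindex (cast_ord cC)) //=.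
by exists (cast_ord (esym cC)) => j _; rewrite (cast_ordK, cast_ordKV).
Qed.

Section Charts.
Context {R : realType} {n : nat} (M : manifold R n).
Implicit Types (c d : chart R n M) (U : set M) (q : M).

Lemma chart_image_open c U : open U -> open (c @` (U `&` chart_dom c)).
Proof.
move=> oU; rewrite openE => _ [q [Uq cq] <-]; rewrite /interior.
have H1 : nbhs (c q) (c @` chart_dom c).
  by apply: open_nbhs_nbhs; split; [exact: chart_img_open|exists q].
have H2 : nbhs (c q) (chart_inv c @^-1` (U `&` chart_dom c)).
  apply: (chart_inv_cont cq); rewrite chart_mapK //; apply: open_nbhs_nbhs; split => //.
  by apply: openI => //; exact: chart_dom_open.
apply: filterS2 H1 H2 => _ [q' cq' <-] /=; rewrite chart_mapK // => Uq'.
by exists q'.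
Qed.

Lemma chart_preimage_open c U (V : set 'rV[R]_n) : open U -> open V ->
  open (U `&` chart_dom c `&` c @^-1` V).
Proof.
move=> oU oV; rewrite openE => q [[Uq cq] Vq]; rewrite /interior.
have H1 : nbhs q (U `&` chart_dom c).
  by apply: open_nbhs_nbhs; split => //; apply: openI => //; exact: chart_dom_open.
have H2 : nbhs q (c @^-1` V).
  by apply: (chart_map_cont cq); apply: open_nbhs_nbhs; split.
by apply: filterS2 H1 H2 => q' h1 h2; split.
Qed.

Lemma smooth_field_sub U U' (f : M -> R) : U' `<=` U -> smooth_field U f ->
    smooth_field U' f.
Proof.
by move=> UU sf c ac; apply: smooth_sub (sf c ac) => x [q [/UU Uq cq] <-]; exists q.
Qed.

Lemma smooth_field_chart c U (V : set 'rV[R]_n) (f : 'rV[R]_n -> R) :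
  atlas c -> open U -> open V -> U `<=` chart_dom c -> (forall q, U q -> V (c q)) ->
  smooth_on V f -> smooth_field U (f \o c).
Proof.
move=> ac oU oV Uc UV sf d ad m.
apply: (@Ck_on_comp _ _ _ f (fun x => c (chart_inv d x)) _ V).
- exact: chart_image_open.
- exact: oV.
- by move=> _ [q [Uq dq] <-]; rewrite chart_mapK //; exact: UV.
- exact: sf.
move=> a; apply: Ck_on_sub (atlas_compatible ad ac a m) => _ [q [Uq dq] <-].
by exists q => //; split => //; exact: Uc.
Qed.

Definition chart_grad k c q (h : 'I_k -> M -> R) : 'M[R]_(k, n) :=
  \matrix_(al, a) cov1 c q (h al) a.

Lemma chart_gradE k c q (h : 'I_k -> M -> R) :
  chart_grad c q h = grad (fun al => h al \o chart_inv c) (c q).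
Proof. by apply/matrixP => al a; rewrite !mxE. Qed.

Lemma cov1_chain c d U q (f : M -> R) b : atlas c -> atlas d -> open U ->
    smooth_field U f ->
  U q -> chart_dom c q -> chart_dom d q ->
  cov1 c q f b = \sum_a cov1 d q f a * transition_jacobian c d q a b.
Proof.
move=> ac ad oU sf Uq cq dq; rewrite /cov1.
pose W := c @` ((U `&` chart_dom d) `&` chart_dom c).
have oW : open W.
  by apply: chart_image_open; apply: openI => //; exact: chart_dom_open.
have Wq : W (c q) by exists q.
pose phi := fun x => d (chart_inv c x).
have E : partiald b (f \o chart_inv c) (c q) = partiald b ((f \o chart_inv d) \o phi) (c q).
  apply: (partiald_on b oW Wq) => _ [q' [[Uq' dq'] cq'] <-].
  by rewrite /phi /= !chart_mapK.
have D := @chain_rule R n n (f \o chart_inv d) phi W (d @` (U `&` chart_dom d)) (c q) b oW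
  (chart_image_open oU) Wq.
have [] := D.
- by rewrite /phi chart_mapK //; exists q.
- exact: (sf d ad 1%N).
- move=> a; apply: Ck_on_sub (atlas_compatible ac ad a 1%N) => _ [q' [[_ dq'] cq'] <-].
  by exists q'.
move=> _ D2; apply: etrans E _; apply: etrans D2 _.
by apply: eq_bigr => a _; rewrite /phi chart_mapK // /transition_jacobian mxE.
Qed.

Lemma chart_grad_chain k c d U q (h : 'I_k -> M -> R) : atlas c -> atlas d -> open U ->
  (forall al, smooth_field U (h al)) -> U q -> chart_dom c q -> chart_dom d q ->
  chart_grad c q h = chart_grad d q h *m transition_jacobian c d q.
Proof.
move=> ac ad oU sh Uq cq dq; apply/matrixP => al b; rewrite !mxE.
rewrite (cov1_chain b ac ad oU (sh al) Uq cq dq); apply: eq_bigr => a _.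
by rewrite !mxE.
Qed.

Variable g : riemannian_metric M.

(** The metric is invertible in both charts, and [metric_tensorial] factors one of its
matrices through the Jacobian matrix of the transition map. *)
Lemma transition_unit c d q : atlas c -> atlas d -> chart_dom c q -> chart_dom d q ->
  transition_jacobian c d q \in unitmx.
Proof.
move=> ac ad cq dq; have := posdef_unit (metric_posdef g ac cq).
by rewrite (metric_tensorial g ac ad cq dq) unitmx_mul => /andP[].
Qed.

Lemma reduced_metricE k (h : 'I_k -> M -> R) c q :
  reduced_metric g h c q = g c (c q) - (chart_grad c q h)^T *m chart_grad c q h.
Proof.
apply/matrixP => a b; rewrite !mxE; congr (_ - _).
by apply: eq_bigr => al _; rewrite !mxE.
Qed.

Lemma gradient_mxE k (h : 'I_k -> M -> R) c q :
  gradient_mx g h c q = cogram_mx (g c) (fun al => h al \o chart_inv c) (c q).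
Proof.
rewrite /cogram_mx -chart_gradE.
have subE (X : 'M[R]_k) al be : (1%:M - X) al be = (al == be)%:R - X al be.
  by rewrite !mxE.
apply/matrixP => al be; rewrite [LHS]mxE subE.
congr (_ - _); rewrite [RHS]mxE exchange_big; apply: eq_bigr => b _.
rewrite [(_ *m _) al b]mxE mulr_suml; apply: eq_bigr => a _.
rewrite /inv_metric_at !mxE /=.
by rewrite [cov1 c q _ _ * invmx _ _ _]mulrC.
Qed.

Section InChart.
Variables (k : nat) (h : 'I_k -> M -> R) (c : chart R n M) (U : set M).
Hypothesis ac : atlas c.
Hypothesis oU : open U.
Hypothesis sh : forall al, smooth_field U (h al).
Let O := c @` (U `&` chart_dom c).
Let hc (al : 'I_k) := h al \o chart_inv c.

Lemma chart_metric_smooth : smooth_mx O (g c).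
Proof.
by move=> a b; apply: smooth_sub (metric_smooth g ac a b) => _ [q [_ cq] <-]; exists q.
Qed.

Lemma chart_metric_sym : symm_on O (g c).
Proof. by move=> _ [q [_ cq] <-]; exact: (Defs.metric_sym g ac cq). Qed.

Lemma chart_metric_unit : unit_on O (g c).
Proof. by move=> _ [q [_ cq] <-]; apply: posdef_unit; exact: metric_posdef. Qed.

Lemma chart_field_smooth al : smooth_on O (hc al).
Proof. exact: sh. Qed.

Let F x := g c x - (grad hc x)^T *m grad hc x.

Lemma reduced_metric_chart q : reduced_metric g h c q = F (c q).
Proof. by rewrite reduced_metricE chart_gradE. Qed.

Hypothesis posF : forall q, U q -> chart_dom c q -> posdefmx (reduced_metric g h c q).

Let uF : unit_on O F.
Proof.
by move=> _ [q [Uq cq] <-]; rewrite -reduced_metric_chart; apply: posdef_unit; exact: posF.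
Qed.

(** The Gauss equation read entry by entry; F is invertible, so that the vanishing of
the curvature may be tested on F times the curvature. *)
Lemma curvature_condition q (j l : 'I_n) : U q -> chart_dom c q ->
  (curvature_mx F j l (c q) = 0 <->
   forall p i : 'I_n,
          \sum_(al < k) \sum_(be < k)
            (cov2 g c q (h al) p j * cov2 g c q (h be) i l
             - cov2 g c q (h al) p l * cov2 g c q (h be) i j)
            * invmx (gradient_mx g h c q) al be
          = curvature_at g c q p i j l).
Proof.
move=> Uq cq; have Ox : O (c q) by exists q.
have oO : open O by exact: chart_image_open.
have G := gauss_equation oO chart_metric_smooth chart_metric_sym chart_metric_unit
    chart_field_smooth uF j l Ox.
pose S m := hessian_mx (g c) hc m (c q).
pose A := invmx (cogram_mx (g c) hc (c q)).
have cov2E al a b : cov2 g c q (h al) a b = S b al a.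
  exact: (hessianE oO hc chart_metric_sym al a b Ox).
have sumE p i : \sum_(al < k) \sum_(be < k)
            (cov2 g c q (h al) p j * cov2 g c q (h be) i l
             - cov2 g c q (h al) p l * cov2 g c q (h be) i j)
            * invmx (gradient_mx g h c q) al be =
     ((S j)^T *m A *m S l - (S l)^T *m A *m S j) p i.
  rewrite gradient_mxE -/hc -/A.
  have E m m' : ((S m)^T *m A *m S m') p i = \sum_al \sum_be S m al p * S m' be i * A al be.
    rewrite mxE exchange_big; apply: eq_bigr => be _.
    rewrite mxE mulr_suml; apply: eq_bigr => al _.
    by rewrite [(S m)^T p al]mxE mulrAC.
  have subE (X Y : 'M[R]_n) : (X - Y) p i = X p i - Y p i by rewrite !mxE.
  apply/esym; apply: etrans (subE _ _) _.
  apply: etrans (congr2 (fun a b : R => a - b) (E j l) (E l j)) _; apply/esym.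
  rewrite -sumrB; apply: eq_bigr => al _; rewrite -sumrB; apply: eq_bigr => be _.
  by rewrite (cov2E al p j) (cov2E be i l) (cov2E al p l) (cov2E be i j) mulrBl.
have curvE p i : curvature_at g c q p i j l =
    (g c (c q) *m curvature_mx (g c) j l (c q)) p i.
  exact: (riemann_mx oO chart_metric_sym p i j l Ox).
have uFx : F (c q) \in unitmx by exact: uF.
split=> [F0 p i|H].
  rewrite sumE curvE; congr (fun_of_matrix _ p i); apply/esym/eqP.
  by rewrite -subr_eq0 -G -/F F0 mulmx0.
rewrite -[LHS](mulKmx uFx) [F (c q) *m _]G -/(S j) -/(S l) -/A.
have -> : g c (c q) *m curvature_mx (g c) j l (c q) =
    (S j)^T *m A *m S l - (S l)^T *m A *m S j.
  by apply/matrixP => p i; rewrite -curvE -H sumE.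
by rewrite subrr mulmx0.
Qed.

End InChart.

End Charts.

(** * The theorem *)

Theorem theorem2p3 (R : realType) (n k : nat) (M : manifold R n)
    (g : riemannian_metric M) :
  local_isometric_immersion g (n + k) <->
  (forall q0 : M, exists U : set M, [/\ open U, U q0 &
    exists h : 'I_k -> M -> R,
      (forall al, smooth_field U (h al)) /\
      forall c q, atlas c -> chart_dom c q -> U q ->
        posdefmx (reduced_metric g h c q) /\
        forall p i j l : 'I_n,
          \sum_(al < k) \sum_(be < k)
            (cov2 g c q (h al) p j * cov2 g c q (h be) i l
             - cov2 g c q (h al) p l * cov2 g c q (h be) i j)
            * invmx (gradient_mx g h c q) al be
          = curvature_at g c q p i j l]).
Proof.
split=> H q0.
- have [U [oU Uq0 [u [su Gu]]]] := H q0.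
  have [c0 [ac0 c0q0]] := atlas_cover q0.
  have gramE c q : atlas c -> chart_dom c q -> U q ->
      (chart_grad c q u)^T *m chart_grad c q u = g c (c q).
    move=> ac cq Uq; apply/matrixP => a b.
    have := Gu c q ac cq Uq a b; rewrite /metric_at => <-.
    by rewrite mxE; apply: eq_bigr => t _; rewrite !mxE.
  (* the Gram matrix of the differentials of u is invertible, hence n of them are
     independent *)
  have full : row_full (chart_grad c0 q0 u).
    apply/row_fullP; exists (invmx (g c0 (c0 q0)) *m (chart_grad c0 q0 u)^T).
    rewrite -mulmxA gramE // mulVmx //; exact: posdef_unit (metric_posdef g _ _).
  pose s := fullrankfun full.
  have [tau tauP] := @complement_inj n k s (@fullrankfun_inj _ _ _ _ full).
  pose w (i : 'I_n) := u (s i); pose h (j : 'I_k) := u (tau j).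
  have sw i : smooth_field U (w i) by exact: su.
  have sh j : smooth_field U (h j) by exact: su.
  have split_gram c q : atlas c -> chart_dom c q -> U q ->
      g c (c q) = (chart_grad c q w)^T *m chart_grad c q w
          + (chart_grad c q h)^T *m chart_grad c q h.
    move=> ac cq Uq; rewrite -gramE //; apply/matrixP => a b; rewrite !mxE tauP.
    by congr (_ + _); apply: eq_bigr => t _; rewrite !mxE.
  pose O := c0 @` (U `&` chart_dom c0).
  have oO : open O by exact: chart_image_open.
  pose dt x := \det (grad (fun i => w i \o chart_inv c0) x).
  have sdt : smooth_on O dt.
    apply: smooth_det => //; apply: smooth_grad => // i; exact: sw.
  have dt0 : dt (c0 q0) != 0.
    rewrite /dt -chart_gradE -unitfE -unitmxE.
    have -> : chart_grad c0 q0 w = rowsub s (chart_grad c0 q0 u).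
      by apply/matrixP => i a; rewrite !mxE.
    by rewrite -row_full_unit; exact: fullrowsub_full.
  (* invertibility of the Jacobian of w is an open condition *)
  pose V := O `&` [set x | dt x != 0].
  have oV : open V.
    rewrite openE => x [Ox dx]; rewrite /interior.
    have H1 : nbhs x O by apply: open_nbhs_nbhs; split.
    have d2 : 0 < `|dt x| / 2 by rewrite divr_gt0 // normr_gt0.
    have H2 := (continuous_ptP _ _).1 (smooth_cont sdt Ox) _ d2.
    apply: filterS2 H1 H2 => y Oy yP; split => //=; apply/eqP => dy; move: yP.
    rewrite dy subr0 ler_pdivlMr // ger_pMr ?normr_gt0 //.
    by rewrite leNgt ltr1n.
  pose U' := U `&` chart_dom c0 `&` c0 @^-1` V.
  have oU' : open U' by exact: chart_preimage_open.
  have sub : U' `<=` U by move=> q [[]].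
  exists U'; split => //.
    by split; [split|split => //; exists q0].
  exists h; split; first by move=> j; apply: smooth_field_sub (sh j).
  have uw c q : atlas c -> chart_dom c q -> U' q -> chart_grad c q w \in unitmx.
    move=> ac cq [[Uq c0q] [_ dq]].
    rewrite (chart_grad_chain ac ac0 oU sw Uq cq c0q) unitmx_mul (transition_unit g) //
        andbT.
    by rewrite unitmxE unitfE chart_gradE.
  have redE c q : atlas c -> chart_dom c q -> U' q ->
      reduced_metric g h c q = (chart_grad c q w)^T *m chart_grad c q w.
    by move=> ac cq /sub Uq; rewrite reduced_metricE split_gram // addrK.
  have posred c q : atlas c -> chart_dom c q -> U' q -> posdefmx (reduced_metric g h c q).
    move=> ac cq Uq; rewrite redE //; apply: posdef_gram => v wv.
    by apply: trmx_inj; rewrite trmx0 -[LHS](mulKmx (uw c q ac cq Uq)) wv mulmx0.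
  move=> c q ac cq Uq; split; first exact: posred.
  move=> p i j l.
  have sh' al : smooth_field U' (h al) by apply: smooth_field_sub (sh al).
  have := @curvature_condition R n M g k h c U' ac oU' sh' (fun q Uq cq =>
      posred c q ac cq Uq) q j l Uq cq.
  case=> + _; apply.
  pose Oc := c @` (U' `&` chart_dom c).
  have oOc : open Oc by exact: chart_image_open.
  have Ox : Oc (c q) by exists q.
  apply: etrans (_ : curvature_mx (fun y => (grad (fun i =>
      w i \o chart_inv c) y)^T *m grad (fun i => w i \o chart_inv c) y) j l (c q) = 0).
    apply: (curvature_mx_ext oOc j l Ox) => _ [q' [Uq' cq'] <-].
    by rewrite -!chart_gradE -reduced_metricE redE.
  apply: (flat_gram oOc j l Ox).
    by move=> i'; apply: smooth_sub (sw i' c ac) => _ [q' [/sub Uq' cq'] <-]; exists q'.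
  by move=> _ [q' [Uq' cq'] <-]; rewrite -chart_gradE; exact: uw.
- have [U [oU Uq0 [h [sh Hh]]]] := H q0.
  have [c0 [ac0 c0q0]] := atlas_cover q0.
  pose O := c0 @` (U `&` chart_dom c0).
  have oO : open O by exact: chart_image_open.
  have Ox0 : O (c0 q0) by exists q0.
  have posred q : U q -> chart_dom c0 q -> posdefmx (reduced_metric g h c0 q).
    by move=> Uq cq; have [] := Hh c0 q ac0 cq Uq.
  pose hc (al : 'I_k) := h al \o chart_inv c0.
  pose F x := g c0 x - (grad hc x)^T *m grad hc x.
  have shc al : smooth_on O (hc al) by exact: sh.
  have sF : smooth_mx O F by apply: reduced_smooth => //; exact: chart_metric_smooth.
  have symF : symm_on O F by apply: reduced_sym => //; exact: chart_metric_sym.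
  have posF x : O x -> posdefmx (F x).
    by move=> [q [Uq cq] <-]; rewrite /F -chart_gradE -reduced_metricE; exact: posred.
  have flatF j l x : O x -> curvature_mx F j l x = 0.
    move=> [q [Uq cq] <-].
    have [_] := @curvature_condition R n M g k h c0 U ac0 oU sh posred q j l Uq cq.
    by apply => p i; have [_] := Hh c0 q ac0 cq Uq; apply.
  have [r r0 [BO [v [sv vF]]]] := flat_coordinates oO Ox0 sF symF posF flatF.
  pose B := ball (c0 q0) r.
  have oB : open B by exact: ball_open.
  pose U' := U `&` chart_dom c0 `&` c0 @^-1` B.
  have oU' : open U' by exact: chart_preimage_open.
  have sub : U' `<=` U by move=> q [[]].
  exists U'; split => //.
    by split => //; exact: ballxx.
  pose w i := v i \o c0.
  pose u (t : 'I_(n + k)) : M -> R :=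
    match fintype.split t with inl i => w i | inr j => h j end.
  have ul i : u (lshift k i) = w i by rewrite /u (unsplitK (inl i)).
  have ur j : u (rshift n j) = h j by rewrite /u (unsplitK (inr j)).
  have sw i : smooth_field U' (w i).
    apply: (smooth_field_chart ac0 oU' oB) (sv i) => q; first by case=> [[]].
    by case.
  have sh' j : smooth_field U' (h j) by apply: smooth_field_sub (sh j).
  exists u; split.
    move=> t; rewrite /u; case: (fintype.split t) => i; [exact: sw|exact: sh'].
  have base q : U' q -> (chart_grad c0 q w)^T *m chart_grad c0 q w
      + (chart_grad c0 q h)^T *m chart_grad c0 q h = g c0 (c0 q).
    move=> [[Uq cq] Bq].
    have -> : chart_grad c0 q w = grad v (c0 q).
      rewrite chart_gradE; apply/matrixP => i a; rewrite [LHS]mxE [RHS]mxE.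
      apply: (partiald_on a oB Bq) => y /BO[q' [_ cq'] <-].
      by rewrite /w /= chart_mapK.
    by rewrite vF // /F chart_gradE subrK.
  move=> c q ac cq Uq a b; have [[_ c0q] _] := Uq.
  have : (chart_grad c q w)^T *m chart_grad c q w
      + (chart_grad c q h)^T *m chart_grad c q h = g c (c q).
    rewrite (metric_tensorial g ac ac0 cq c0q) -base //.
    rewrite (chart_grad_chain ac ac0 oU' sw Uq cq c0q).
    rewrite (chart_grad_chain ac ac0 oU' sh' Uq cq c0q).
    by rewrite !trmx_mul mulmxDr mulmxDl !mulmxA.
  rewrite /metric_at => <-; rewrite big_split_ord !mxE; congr (_ + _).
    by apply: eq_bigr => i _; rewrite ul !mxE.
  by apply: eq_bigr => j _; rewrite ur !mxE.
Qed.
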